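(* Let $k$ be an algebraically closed field of characteristic zero, let $f\in R=k[x,y,z]$ be a reduced homogeneous polynomial of degree $4$, and let $X=V(f)\subset\mathbb{P}_k^2$ be the reduced quartic curve defined by $f$. If $X$ is singular, then $X$ is of gradient linear type, i.e. the gradient ideal $J(f)=(\partial f/\partial x,\partial f/\partial y,\partial f/\partial z)\subset R$ is of linear type.
   Context: A reduced polynomial is one without multiple factors. An ideal $I=(f_1,\ldots,f_m)$ of a commutative Noetherian ring $A$ is of linear type if the natural surjective $A$-algebra homomorphism $\mathrm{Sym}_A(I)\to\mathcal{R}_A(I)=A[f_1t,\ldots,f_mt]\subset A[t]$ from the symmetric algebra to the Rees algebra of $I$ is injective. *)

(* Defs.v *)
From HB Require Import structures.
From mathcomp Require Import all_boot all_order all_algebra.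
From mathcomp Require Import ring_quotient generic_quotient.
From mathcomp Require Import finmap.
From mathcomp Require Import boolp.
From mathcomp Require monalg mpoly.

Set Implicit Arguments.
Unset Strict Implicit.
Unset Printing Implicit Defensive.

Import GRing.Theory.
Local Open Scope ring_scope.

(* monalg and mpoly define clashing notations, so monalg is imported only     *)
(* inside this module, and mpoly only after it.                               *)
Module FreeCommutativeAlgebra.
Import monalg.

Section FreeCommutativeAlgebra.
Variables (A : comNzRingType) (V : choiceType).

Lemma mkmalgU_scale (m : cmonom V) (c : A) : mkmalgU m c = c *: mkmalgU m 1.
Proof.
apply/malgP=> l; transitivity (c *+ (m == l)); first exact: mcoeffU.
transitivity (c * mcoeff l (mkmalgU m 1)); last exact/esym/mcoeffZ.
transitivity (c * (1 *+ (m == l))).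
  by case: eqP => _; rewrite ?mulr1 ?mulr0.
by congr (c * _); exact/esym/mcoeffU.
Qed.

Lemma mkmalgU_mul : {morph (fun m : cmonom V => mkmalgU m (1 : A)) :
  m n / mmul m n >-> m * n}.
Proof.
move=> m n; transitivity (mkmalgU (mmul m n) (1 * 1 : A)).
  by rewrite mulr1.
exact/esym/fgmulUU.
Qed.

(* The polynomial ring over A with one variable for each element of V (which  *)
(* may be infinite).                                                          *)
Definition free_calg : Type := malg (cmonom V) A.
HB.instance Definition _ := GRing.ComAlgebra.copy free_calg (malg (cmonom V) A).

End FreeCommutativeAlgebra.

(* Locked, since unfolding these in failing conversions is very slow.         *)
HB.lock Definition free_var (A : comNzRingType) (V : choiceType) (v : V) :
  free_calg A V := mkmalgU (ucm v) 1.

Section MonomialLift.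
Variables (A : comNzRingType) (V : choiceType) (B : comAlgType A) (h : V -> B).

Definition mon_lift (m : cmonom V) : B := \prod_(v <- finsupp m) h v ^+ m v.

Lemma mon_liftEw (m : cmonom V) (E : {fset V}) : (finsupp m `<=` E)%fset ->
  mon_lift m = \prod_(v <- E) h v ^+ m v.
Proof.
move=> le; rewrite /mon_lift (big_fset_incl _ le) //= => v _.
by rewrite -cmE_neq0 negbK => /eqP->; rewrite expr0.
Qed.

Lemma mon_lift_mmorphism : mmorphism mon_lift.
Proof.
split=> [m1 m2|]; last by rewrite /mon_lift mdom1 big_seq_fset0.
rewrite (mon_liftEw (fsubsetUl (finsupp m1) (finsupp m2))).
rewrite (mon_liftEw (fsubsetUr (finsupp m1) (finsupp m2))).
rewrite -big_split /=.
by rewrite /mon_lift mdomD; apply: eq_bigr => v _; rewrite cmM exprD.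
Qed.
HB.instance Definition _ := isMultiplicative.Build (cmonom V) B mon_lift
  mon_lift_mmorphism.

End MonomialLift.

HB.lock Definition free_lift (A : comNzRingType) (V : choiceType)
    (B : comAlgType A) (h : V -> B) (F : free_calg A V) : B :=
  mmap (in_alg B) (mon_lift h) F.

Section FreeCommutativeAlgebraTheory.
Variables (A : comNzRingType) (V : choiceType).

Section Lift.
Variables (B : comAlgType A) (h : V -> B).
Local Notation free_lift := (@free_lift A V B h).

Lemma free_lift_linear : linear free_lift.
Proof.
rewrite free_lift.unlock => a F G; rewrite [LHS]raddfD /=; congr (_ + _).
by rewrite [LHS]mmapZ /= mulr_algl.
Qed.
Lemma free_lift_monoid_morphism : monoid_morphism free_lift.
Proof.
rewrite free_lift.unlock.
by split=> [|F G]; [exact: rmorph1 | exact: rmorphM].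
Qed.
HB.instance Definition _ := GRing.isLinear.Build A (free_calg A V) B *:%R
  free_lift free_lift_linear.
HB.instance Definition _ := GRing.isMonoidMorphism.Build (free_calg A V) B
  free_lift free_lift_monoid_morphism.

Lemma free_lift_var v : free_lift (free_var A v) = h v.
Proof.
rewrite free_lift.unlock free_var.unlock mmapU /= scale1r mul1r /mon_lift mdomU.
by rewrite big_seq_fset1 cmUU expr1.
Qed.
End Lift.

Lemma cmonomE (m : cmonom V) :
  m = \big[mmul/mone]_(v <- finsupp m) iter (m v) (mmul (ucm v)) mone.
Proof.
have iterE u n v : iter n (mmul (ucm u)) mone v = (n * (u == v))%N.
  elim: n => [|n IHn] /=; first by rewrite cm1.
  by rewrite cmM IHn cmU mulSn.
apply/eqP/cmP=> v.
rewrite (big_morph (fun m : cmonom V => m v) (cmM v) (cm1 v)).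
under eq_bigr do rewrite iterE.
case: (mdomP m v) => vm.
  rewrite (big_fsetD1 v) //= eqxx muln1 big_seq big1 ?addn0 // => u.
  by rewrite in_fsetD1 => /andP[/negPf-> _]; rewrite muln0.
rewrite big_seq big1 // => u um; case: eqVneq => [uv|_]; last by rewrite muln0.
by rewrite -uv um in vm.
Qed.

Lemma free_calg_ind (P : free_calg A V -> Prop) :
    (forall a, P a%:A) -> (forall v, P (free_var A v)) ->
    (forall F G, P F -> P G -> P (F + G)) ->
    (forall F G, P F -> P G -> P (F * G)) ->
  forall F, P F.
Proof.
move=> PC Pvar PD PM F.
have P0 : P 0 by rewrite -(scale0r 1); apply: PC.
have P1 : P 1 by rewrite -(scale1r 1); apply: PC.
have -> : F = \sum_(m <- msupp F) (mkmalgU m (mcoeff m F) : free_calg A V).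
  exact: monalgE.
elim: (enum_fset (msupp F)) => [|m r IHr]; first by rewrite big_nil; exact: P0.
rewrite big_cons; apply: (PD); last exact: IHr.
have -> : (mkmalgU m (mcoeff m F) : free_calg A V) =
          (mcoeff m F)%:A * mkmalgU m 1.
  rewrite mulr_algl; exact: mkmalgU_scale.
apply: (PM); first exact: (PC).
have U1M : {morph (fun m => mkmalgU m 1 : free_calg A V) :
  m n / mmul m n >-> m * n} by exact: mkmalgU_mul.
rewrite (cmonomE m) (big_morph _ U1M (erefl 1)).
elim: (enum_fset (finsupp m)) => [|v q IHq].
  by rewrite big_nil; exact: P1.
rewrite big_cons; apply: (PM); last exact: IHq.
elim: (m v) => [|n IHn]; first exact: P1.
rewrite /= U1M; apply: (PM); last exact: IHn.
by have := Pvar v; rewrite free_var.unlock; apply.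
Qed.

End FreeCommutativeAlgebraTheory.
End FreeCommutativeAlgebra.
Export FreeCommutativeAlgebra.

Section IdealSpan.
Variables (R : comNzRingType) (P : R -> Prop).

Definition ideal_span : {pred R} := fun x =>
  `[< exists2 s : seq (R * R),
        forall p, p \in s -> P p.2 & x = \sum_(p <- s) p.1 * p.2 >].

Lemma mem_ideal_span x : P x -> x \in ideal_span.
Proof.
move=> Px; apply/asboolP; exists [:: (1, x)] => [p|].
  by rewrite inE => /eqP->.
by rewrite big_seq1 mul1r.
Qed.

Lemma ideal_span0 : 0 \in ideal_span.
Proof. by apply/asboolP; exists [::] => //; rewrite big_nil. Qed.

Lemma ideal_spanP a : {in ideal_span &, forall u v, a * u + v \in ideal_span}.
Proof.
move=> u v /asboolP[s sP ->] /asboolP[r rP ->]; apply/asboolP.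
exists ([seq (a * p.1, p.2) | p <- s] ++ r) => [p|].
  by rewrite mem_cat => /orP[/mapP[q /sP qP ->]|/rP].
rewrite big_cat big_map mulr_sumr; congr (_ + _).
by apply: eq_bigr => p _; rewrite mulrA.
Qed.

Lemma ideal_span_eq0 (S : comNzRingType) (g : {rmorphism R -> S}) x :
  (forall y, P y -> g y = 0) -> x \in ideal_span -> g x = 0.
Proof.
move=> g0 /asboolP[s sP ->]; rewrite rmorph_sum big_seq big1 // => p /sP Pp.
by rewrite rmorphM /= (g0 _ Pp) mulr0.
Qed.
End IdealSpan.

Section QuotientAlgebra.
Variables (A : comNzRingType) (F : comAlgType A) (I : idealr F).

Definition quot_alg : Type := {ideal_quot I}.
HB.instance Definition _ := GRing.ComNzRing.copy quot_alg {ideal_quot I}.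

Definition quot_pi (x : F) : quot_alg := \pi_{ideal_quot I}%qT x.

Lemma quot_piD : {morph quot_pi : x y / x + y}.
Proof. by move=> x y; rewrite /quot_pi !piE. Qed.
Lemma quot_piM : {morph quot_pi : x y / x * y}.
Proof. by move=> x y; rewrite /quot_pi !piE. Qed.
Lemma quot_pi1 : quot_pi 1 = 1.
Proof. by rewrite /quot_pi !piE. Qed.

Definition quot_scale (a : A) (x : quot_alg) : quot_alg := quot_pi a%:A * x.

Lemma quot_scaleA a b x : quot_scale a (quot_scale b x) = quot_scale (a * b) x.
Proof. by rewrite /quot_scale mulrA -quot_piM mulr_algl scalerA. Qed.
Lemma quot_scale1 : left_id 1 quot_scale.
Proof. by move=> x; rewrite /quot_scale scale1r quot_pi1 mul1r. Qed.
Lemma quot_scaleDr : right_distributive quot_scale +%R.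
Proof. by move=> a x y; rewrite /quot_scale mulrDr. Qed.
Lemma quot_scaleDl x : {morph quot_scale^~ x : a b / a + b}.
Proof. by move=> a b; rewrite /quot_scale scalerDl quot_piD mulrDl. Qed.
HB.instance Definition _ := GRing.Zmodule_isLmodule.Build A quot_alg
  quot_scaleA quot_scale1 quot_scaleDr quot_scaleDl.

Lemma quot_scaleAl a (x y : quot_alg) : a *: (x * y) = a *: x * y.
Proof. exact: mulrA. Qed.
HB.instance Definition _ :=
  GRing.Lmodule_isLalgebra.Build A quot_alg quot_scaleAl.
HB.instance Definition _ := GRing.Lalgebra_isComAlgebra.Build A quot_alg.

Lemma quot_pi_linear : linear quot_pi.
Proof. by move=> a x y; rewrite quot_piD -mulr_algl quot_piM. Qed.
HB.instance Definition _ := GRing.isLinear.Build A F quot_alg *:%R quot_pi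
  quot_pi_linear.
HB.instance Definition _ := GRing.isMonoidMorphism.Build F quot_alg quot_pi
  (quot_pi1, quot_piM).

Lemma quot_pi_eq x y : quot_pi x = quot_pi y <-> x - y \in (I : pred F).
Proof. by rewrite Quotient.idealrBE; split=> [/eqP|/eqP]. Qed.
Lemma quot_piP (x : quot_alg) : exists y, x = quot_pi y.
Proof. by exists (repr x); rewrite /quot_pi reprK. Qed.

Section QuotientLift.
Variables (B : comAlgType A) (g : {lrmorphism F -> B}).
Variable (g_ideal : forall x, x \in (I : pred F) -> g x = 0).

Definition quot_lift (x : quot_alg) : B := g (repr x).

Lemma quot_lift_pi x : quot_lift (quot_pi x) = g x.
Proof.
apply/eqP; rewrite -subr_eq0 -raddfB; apply/eqP/g_ideal.
by apply/quot_pi_eq; rewrite /quot_pi reprK.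
Qed.
Lemma quot_lift_linear : linear quot_lift.
Proof.
move=> a x y; have [u ->] := quot_piP x; have [v ->] := quot_piP y.
by rewrite -linearP !quot_lift_pi linearP.
Qed.
Lemma quot_lift_monoid_morphism : monoid_morphism quot_lift.
Proof.
split=> [|x y]; first by rewrite -quot_pi1 quot_lift_pi rmorph1.
have [u ->] := quot_piP x; have [v ->] := quot_piP y.
by rewrite -quot_piM !quot_lift_pi rmorphM.
Qed.
End QuotientLift.
End QuotientAlgebra.

Section SymmetricAlgebra.
Variables (A : comNzRingType) (M : lmodType A).
Local Notation free := (free_calg A M).

Definition sym_var (u : M) : free := free_var A u.

Inductive sym_relation : free -> Prop :=
| SymRelationD u v : sym_relation (sym_var (u + v) - sym_var u - sym_var v)
| SymRelationZ a u : sym_relation (sym_var (a *: u) - a *: sym_var u).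

Definition sym_ideal : {pred free} := ideal_span sym_relation.

Section LiftIdeal.
Variables (B : comAlgType A) (phi : {linear M -> B}).

Definition mod_lift : free -> B := free_lift phi.
HB.instance Definition _ := GRing.LRMorphism.on mod_lift.

Lemma mod_lift_var u : mod_lift (sym_var u) = phi u.
Proof. exact: free_lift_var. Qed.

Lemma mod_lift_ideal F : F \in sym_ideal -> mod_lift F = 0.
Proof.
apply: ideal_span_eq0 => _ [u v|a u].
  by rewrite !(raddfB mod_lift) /= !mod_lift_var raddfD addrAC addrK subrr.
rewrite (raddfB mod_lift) /= [mod_lift (_ *: _)]linearZ /= !mod_lift_var.
by rewrite linearZ subrr.
Qed.
End LiftIdeal.

Lemma sym_ideal_closed : idealr_closed sym_ideal.
Proof.
split; [exact: ideal_span0| |exact: ideal_spanP].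
apply/negP => /(@mod_lift_ideal A^o (\0 : {linear M -> A^o})).
by rewrite rmorph1; apply/eqP/oner_neq0.
Qed.
HB.instance Definition _ := isIdealr.Build free sym_ideal sym_ideal_closed.

Definition sym : Type := quot_alg sym_ideal.
HB.instance Definition _ := GRing.ComAlgebra.copy sym (quot_alg sym_ideal).

Definition sym_pi (F : free) : sym := quot_pi sym_ideal F.
HB.instance Definition _ := GRing.isLinear.Build A free sym *:%R sym_pi
  (quot_pi_linear sym_ideal).
HB.instance Definition _ := GRing.isMonoidMorphism.Build free sym sym_pi
  (quot_pi1 sym_ideal, quot_piM sym_ideal).

Definition sym_in (u : M) : sym := sym_pi (sym_var u).

Lemma sym_in_linear : linear sym_in.
Proof.
move=> a u v; rewrite /sym_in -linearP.
transitivity (sym_pi (sym_var (a *: u) + sym_var v)); apply/quot_pi_eq.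
  by rewrite opprD addrA; apply/mem_ideal_span/SymRelationD.
by rewrite opprD addrACA subrr addr0; apply/mem_ideal_span/SymRelationZ.
Qed.
HB.instance Definition _ := GRing.isLinear.Build A M sym *:%R sym_in
  sym_in_linear.

Lemma sym_ind (P : sym -> Prop) :
    (forall a, P a%:A) -> (forall u, P (sym_in u)) ->
    (forall x y, P x -> P y -> P (x + y)) ->
    (forall x y, P x -> P y -> P (x * y)) ->
  forall x, P x.
Proof.
move=> PC Pin PD PM x; have [F ->] := quot_piP x.
elim/free_calg_ind: F => [a|u|F G PF PG|F G PF PG].
- by have := PC a; rewrite -(rmorph1 sym_pi) -linearZ.
- exact: Pin.
- by rewrite raddfD; apply: PD.
- by rewrite rmorphM; apply: PM.
Qed.

Section UniversalProperty.
Variables (B : comAlgType A) (phi : {linear M -> B}).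

Definition sym_lift : sym -> B := @quot_lift A free sym_ideal B (mod_lift phi).
HB.instance Definition _ := GRing.isLinear.Build A sym B *:%R sym_lift
  (quot_lift_linear (@mod_lift_ideal B phi)).
HB.instance Definition _ := GRing.isMonoidMorphism.Build sym B sym_lift
  (quot_lift_monoid_morphism (@mod_lift_ideal B phi)).

Lemma sym_lift_in u : sym_lift (sym_in u) = phi u.
Proof.
rewrite -(mod_lift_var phi u); exact: (quot_lift_pi (@mod_lift_ideal B phi)).
Qed.

Lemma sym_lift_unique (g : {lrmorphism sym -> B}) :
  (forall u, g (sym_in u) = phi u) -> g =1 sym_lift.
Proof.
move=> gin; elim/sym_ind => [a|u|x y IHx IHy|x y IHx IHy].
- by rewrite !linearZ !rmorph1.
- by rewrite gin sym_lift_in.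
- by rewrite !raddfD /= IHx IHy.
- by rewrite !rmorphM /= IHx IHy.
Qed.

End UniversalProperty.
End SymmetricAlgebra.

Module LinearType.
Section LinearType.
Import mpoly.
Variables (A : comNzRingType) (m : nat) (f : 'I_m -> A).

Definition ideal_pred : {pred A^o} := fun g =>
  `[< exists c : 'I_m -> A, g = \sum_i c i * f i >].

Lemma ideal_pred_closed : submod_closed ideal_pred.
Proof.
split=> [|a _ _ /asboolP[c ->] /asboolP[d ->]]; apply/asboolP.
  by exists (fun _ => 0); rewrite big1 // => i _; rewrite mul0r.
exists (fun i => a * c i + d i); rewrite scaler_sumr -big_split /=.
by apply: eq_bigr => i _; rewrite mulrDl -mulrA.
Qed.
HB.instance Definition _ := GRing.isSubmodClosed.Build A A^o ideal_pred
  ideal_pred_closed.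

Record ideal : Type := Ideal { ideal_val : A^o; _ : ideal_val \in ideal_pred }.
HB.instance Definition _ := [isSub for ideal_val].
HB.instance Definition _ := [Choice of ideal by <:].
HB.instance Definition _ := [SubChoice_isSubLmodule of ideal by <:].

Definition ideal_shift (u : ideal) : {poly A} := (val u)%:P * 'X.

Lemma ideal_shift_linear : linear ideal_shift.
Proof.
move=> a u v; rewrite /ideal_shift linearP /= polyCD polyCM mulrDl -mulrA.
by rewrite mul_polyC.
Qed.
HB.instance Definition _ := GRing.isLinear.Build A ideal {poly A} *:%R
  ideal_shift ideal_shift_linear.

(* The natural map Sym_A(I) -> A[t], u |-> u t for u in I. Its codomain is    *)
(* A[t] instead of the Rees algebra A[f_1 t, ..., f_m t], which is its image  *)
(* by sym_to_poly_image; this does not affect injectivity.                    *)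
Definition sym_to_poly : sym ideal -> {poly A} := sym_lift ideal_shift.

Definition of_linear_type : Prop := injective sym_to_poly.

Definition rees_algebra : {pred {poly A}} := fun p =>
  `[< exists P : {mpoly A[m]},
        p = mmap polyC (fun i => (f i)%:P * 'X) P >].

Lemma rees_algebra_mmap P :
  mmap polyC (fun i => (f i)%:P * 'X) P \in rees_algebra.
Proof. by apply/asboolP; exists P. Qed.

Lemma ideal_gen_subproof i : f i \in ideal_pred.
Proof.
apply/asboolP; exists (fun j => (j == i)%:R).
rewrite (bigD1 i) //= eqxx mul1r big1 ?addr0 // => j /negPf->.
by rewrite mul0r.
Qed.
Definition ideal_gen i : ideal := Ideal (ideal_gen_subproof i).

Lemma sym_to_poly_image p :
  p \in rees_algebra <-> exists x, p = sym_to_poly x.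
Proof.
split=> [/asboolP[P ->]|[x ->]].
  exists (mmap (in_alg (sym ideal)) (fun i => sym_in (ideal_gen i)) P).
  rewrite /sym_to_poly /mmap rmorph_sum; apply: eq_bigr => c _.
  rewrite rmorphM; congr (_ * _).
    by rewrite /= linearZ rmorph1 /= -mul_polyC mulr1.
  rewrite /mmap1 rmorph_prod; apply: eq_bigr => i _.
  by rewrite rmorphXn; congr (_ ^+ _); apply/esym/sym_lift_in.
elim/sym_ind: x => [a|u|x y /asboolP[P IHx] /asboolP[Q IHy]|
                    x y /asboolP[P IHx] /asboolP[Q IHy]].
- have := rees_algebra_mmap a%:MP; rewrite mmapC.
  by rewrite /sym_to_poly linearZ rmorph1 /= -mul_polyC mulr1.
- rewrite /sym_to_poly sym_lift_in /=; have /asboolP[c gE] := valP u.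
  have := rees_algebra_mmap (\sum_i (c i)%:MP * 'X_i); rewrite rmorph_sum /=.
  rewrite /ideal_shift gE rmorph_sum mulr_suml.
  under eq_bigr do rewrite rmorphM /= mmapC mmapX mmap1U mulrA -polyCM.
  by [].
- rewrite [sym_to_poly _](rmorphD (sym_lift ideal_shift)) [X in X + _]IHx.
  by rewrite [X in _ + X]IHy -rmorphD; apply: rees_algebra_mmap.
- rewrite [sym_to_poly _](rmorphM (sym_lift ideal_shift)) [X in X * _]IHx.
  by rewrite [X in _ * X]IHy -rmorphM; apply: rees_algebra_mmap.
Qed.

End LinearType.
End LinearType.
Export LinearType.

Import mpoly.

(* f has no multiple factor; in particular f is nonzero.                      *)
Definition reduced_mpoly (k : fieldType) (n : nat) (f : {mpoly k[n]}) : Prop :=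
  forall g h : {mpoly k[n]}, f = g ^+ 2 * h -> g \is a GRing.unit.

Definition gradient (k : fieldType) (n : nat) (f : {mpoly k[n]}) (i : 'I_n) :
  {mpoly k[n]} := f^`M(i).

(* For homogeneous reduced f: the projective hypersurface V(f) has a singular *)
(* point, given by homogeneous coordinates v (Jacobian criterion).            *)
Definition singular_hypersurface (k : fieldType) (n : nat) (f : {mpoly k[n]}) :
    Prop :=
  exists v : 'I_n -> k,
    [/\ exists i, v i != 0, f.@[v] = 0 & forall i, (gradient f i).@[v] = 0].

Definition gradient_linear_type (k : fieldType) (n : nat) (f : {mpoly k[n]}) :
  Prop := of_linear_type (gradient f).

(* Main.v *)
From HB Require Import structures.
Require Import Defs.
From mathcomp Require Import all_boot all_algebra mpoly.
From mathcomp Require Import boolp ring zify.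
Import GRing.Theory.
Local Open Scope ring_scope.

(** Write A = k[x, y, z], let f_0, f_1, f_2 be the partial derivatives of f and
    S = A[T_0, T_1, T_2]. The symmetric algebra of J(f) is S / L, where L is
    generated by the linear forms sum a_l T_l with sum a_l f_l = 0, and J(f) is
    of linear type if and only if L contains every form F in T such that
    F(f_0, f_1, f_2) = 0.

    The algebraic half of the proof is a criterion for this, valid for a triple
    f_0, f_1, f_2 of elements of any factorial domain A
    ([linear_type_criterion]): it is enough that the entries of the syzygies of
    (f_0, f_1, f_2) generate an ideal whose radical contains a regular sequence
    x, y, z. If a is a syzygy, then modulo L the form a_i ^ d F of degree d no
    longer involves T_i, and a form in two variables vanishing at (f_j, f_k) is
    a multiple of (f_k T_j - f_j T_k) / gcd (f_j, f_k), which is in L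
    ([syzygy_entry_power]). So powers of x, y and z bring F into L. They can be
    removed because L has no (x, y, z)-torsion: the syzygies of (f, T) are the
    multiples of the cross product of f and T ([cross_product_generates]), a
    free module of rank one, whose second local cohomology vanishes
    ([linear_relation_socle]).

    For the gradient of a reduced f, elimination gives forms in each pair of
    variables that belong to J(f) ([eliminant]), so there are finitely many
    points to consider and an elementary Nullstellensatz applies
    ([projective_nullstellensatz]). It remains to find at each singular point p
    a syzygy of the gradient that does not vanish at p
    ([gradient_linear_type_of_local]). By the Euler identity this means that,
    in an affine chart around p, the equation of the curve lies in the ideal of
    its two partial derivatives in the local ring at p.

    This holds because the singularities of a reduced quartic are
    quasihomogeneous. Put p at (0 : 0 : 1). At a double point some second
    derivative, say that along x, is nonzero, and the polar curve f_x = 0 is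
    smooth at p; the restriction of f to it vanishes to some order n + 1, its
    derivative vanishes to order n, and so f belongs to (f_x, f_y)
    ([smooth_polar]). At a triple point whose tangent cone is reduced
    (type D4), and at those whose tangent cone has a double line (types D5, D6,
    E6, E7), Nakayama's lemma applied to the monomials of high weight shows that
    they belong to (f_x, f_y) ([triple_point_D4], [triple_point_DE]); a further
    degeneration would make f divisible by the square of a line. At a quadruple
    point f does not involve z, and (0, 0, 1) is a syzygy. *)

Set Implicit Arguments.
Unset Strict Implicit.
Unset Printing Implicit Defensive.

(** * Factorial rings and polynomials *)

Definition divides (R : comNzRingType) (p a : R) : Prop := exists c, a = p * c.

Definition prime_element (R : comUnitRingType) (p : R) : Prop :=
  [/\ p != 0, p \isn't a GRing.unit &
      forall a b, divides p (a * b) -> divides p a \/ divides p b].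

Definition prime_factored (R : comUnitRingType) (a : R) : Prop :=
  exists u (s : seq R), [/\ u \is a GRing.unit,
    forall p, p \in s -> prime_element p & a = u * \prod_(p <- s) p].

(** Existence of a factorization into primes, instead of irreducibles, makes
    uniqueness automatic. *)
Definition factorial_ring (R : comUnitRingType) : Prop :=
  forall a : R, a != 0 -> prime_factored a.

Section Divides.
Variable R : comNzRingType.
Implicit Types a b p : R.

Lemma divides0 p : divides p 0. Proof. by exists 0; rewrite mulr0. Qed.
Lemma dividesMl p a : divides p (p * a). Proof. by exists a. Qed.
Lemma dividesD p a b : divides p a -> divides p b -> divides p (a + b).
Proof. by move=> [c ->] [d ->]; exists (c + d); rewrite mulrDr. Qed.
Lemma divides_mull p a b : divides p b -> divides p (a * b).
Proof. by move=> [c ->]; exists (a * c); rewrite mulrCA. Qed.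
Lemma divides_mulr p a b : divides p a -> divides p (a * b).
Proof. by rewrite mulrC; apply: divides_mull. Qed.
Lemma dividesN p a : divides p a -> divides p (- a).
Proof. by move=> [c ->]; exists (- c); rewrite mulrN. Qed.
Lemma dividesB p a b : divides p a -> divides p b -> divides p (a - b).
Proof. by move=> da db; apply: dividesD => //; apply: dividesN. Qed.
End Divides.

Lemma prime_divides_prod (R : comUnitRingType) (p : R) (s : seq R) :
  prime_element p -> divides p (\prod_(q <- s) q) ->
  exists2 q, q \in s & divides p q.
Proof.
move=> [_ pNu pP]; elim: s => [|q s IHs].
  rewrite big_nil => -[c pc]; case/negP: pNu.
  by apply/unitrP; exists c; rewrite mulrC -pc.
rewrite big_cons => /pP[dq|/IHs[r rs dr]]; first by exists q; rewrite ?mem_head.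
by exists r; rewrite // in_cons rs orbT.
Qed.

Lemma prime_factoredM (R : comUnitRingType) (a b : R) :
  prime_factored a -> prime_factored b -> prime_factored (a * b).
Proof.
move=> [u [s [uu sP ->]]] [v [t [vu tP ->]]]; exists (u * v), (s ++ t); split.
- by rewrite unitrM uu vu.
- by move=> p; rewrite mem_cat => /orP[/sP|/tP].
- by rewrite big_cat mulrACA.
Qed.

Lemma prime_prime_factored (R : comUnitRingType) (p : R) :
  prime_element p -> prime_factored p.
Proof.
move=> pp; exists 1, [:: p]; rewrite unitr1 big_seq1 mul1r; split=> // q.
by rewrite inE => /eqP ->.
Qed.

Section FactorialTheory.
Variable R : idomainType.
Implicit Types p a b u : R.

Lemma factorial_ind (P : R -> Prop) : factorial_ring R ->
  (forall u, u \is a GRing.unit -> P u) ->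
  (forall p a, prime_element p -> a != 0 -> P a -> P (p * a)) ->
  forall a, a != 0 -> P a.
Proof.
move=> factR Pu Pp a a0; have [u [s [uu sP aE]]] := factR a a0.
rewrite {a}aE in a0 *; elim: s sP a0 => [|p s IHs] sP.
  by rewrite big_nil mulr1 => _; apply: Pu.
rewrite big_cons mulrCA mulf_eq0 negb_or => /andP[_ a0].
apply: Pp => //; first by apply: sP; rewrite mem_head.
by apply: IHs => // q qs; apply: sP; rewrite inE qs orbT.
Qed.

(** A prime p dividing the product divides one of the factors, which is then
    associated to p and can be removed. *)
Lemma prime_factored_divide p b u (s : seq R) : prime_element p ->
  u \is a GRing.unit -> (forall q, q \in s -> prime_element q) ->
  u * \prod_(q <- s) q = p * b ->
  exists v r, [/\ v \is a GRing.unit, forall q, q \in r -> prime_element q,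
    (size r < size s)%N & b = v * \prod_(q <- r) q].
Proof.
move=> pp uu sP sE; have [p0 pNu _] := pp.
have [q qs [v qE]] : exists2 q, q \in s & divides p q.
  apply: prime_divides_prod => //; exists (u^-1 * b).
  by rewrite mulrCA -sE mulKr.
have [q0 qNu qP] := sP _ qs.
have vu : v \is a GRing.unit.
  have [[w pE]|[w vE]] : divides q p \/ divides q v.
  - by apply: qP; rewrite -qE; exists 1; rewrite mulr1.
  - apply/unitrP; exists w; rewrite [v * w]mulrC; split; apply: (mulfI q0);
      by rewrite mulr1 mulrA -pE.
  have pw : p * w = 1 by apply: (mulfI q0); rewrite mulr1 {2}qE vE; ring.
  by case/negP: pNu; apply/unitrP; exists w; rewrite mulrC.
exists (u * v), (rem q s); split.
- by rewrite unitrM uu vu.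
- by move=> r /mem_rem/sP.
- by rewrite size_rem //; case: (s) qs.
by apply: (mulfI p0); rewrite -sE (big_rem q qs) /= qE; ring.
Qed.
End FactorialTheory.

Section FactorialPoly.
Variable R : idomainType.
Implicit Types a b : {poly R}.

(** Gauss's lemma. If p divides a b, then it divides the product of the leading
    coefficients, hence one of the two; the leading term so divisible can be
    dropped, which decreases the total size. *)
Lemma polyC_prime (p : R) : prime_element p -> prime_element p%:P.
Proof.
move=> [p0 pNu pP]; split; first by rewrite polyC_eq0.
  by rewrite poly_unitE coefC /= (negPf pNu) andbF.
have lead (a : {poly R}) : exists2 a' : {poly R}, (size a' <= (size a).-1)%N &
    a = a' + (lead_coef a)%:P * 'X^((size a).-1).
  exists (\poly_(i < (size a).-1) a`_i); first exact: size_poly.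
  apply/polyP=> i; rewrite coefD coef_poly coefCM coefXn.
  case: ltngtP => [lt|lt|->]; rewrite ?mulr0 ?addr0 ?mulr1 ?add0r //.
  by rewrite nth_default // -ltnS; case: (size a) lt => // n; rewrite ltnS.
move=> a b; have [n] := ubnP (size a + size b); elim: n a b => // n IHn a b.
wlog: a b / a != 0 /\ b != 0 /\ divides p (lead_coef a).
  move=> wl; rewrite ltnS => le d.
  have [->|a0] := eqVneq a 0; first by left; apply: divides0.
  have [->|b0] := eqVneq b 0; first by right; apply: divides0.
  have : divides p (lead_coef (a * b)).
    case: d => c abE; exists (lead_coef c).
    by rewrite abE lead_coefM lead_coefC.
  rewrite lead_coefM => /pP[da|db]; first exact: wl.
  by apply/or_comm; apply: wl => //; [rewrite addnC | rewrite mulrC].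
move=> [a0 [b0 [c lcE]]]; have [a' sa' aE] := lead a.
rewrite ltnS => le d.
have pa : divides p%:P (a - a').
  by rewrite [X in X - _]aE addrC addKr lcE polyCM -mulrA; apply: dividesMl.
have lta' : (size a' < size a)%N by rewrite -[size a]prednK ?size_poly_gt0.
have lt : (size a' + size b < n)%N.
  by apply: leq_trans le; rewrite ltn_add2r.
have da'b : divides p%:P (a' * b).
  have -> : a' * b = a * b - (a - a') * b by ring.
  by apply: dividesB => //; apply: divides_mulr.
case: (IHn _ _ lt da'b) => [da'|]; [left | by right].
by rewrite -(subrK a' a); apply: dividesD.
Qed.

Definition primitive_poly a := forall p : R, prime_element p -> ~ divides p%:P a.

Hypothesis factR : factorial_ring R.

(** A factorization over the fraction field comes from one over R: each prime of
    c divides one of the two factors and cancels there. *)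
Lemma split_const c a b h : c != 0 -> c%:P * a = b * h ->
  exists b' h' : {poly R}, [/\ size b' = size b, size h' = size h & a = b' * h'].
Proof.
move=> c0; move: c c0 b h; apply: (factorial_ind factR) => [u uu|p c pp c0 IHc] b h.
  move=> ua; exists (u^-1%:P * b), h; split => //.
    by rewrite mul_polyC size_scale // invr_eq0; case: eqP uu => // ->; rewrite unitr0.
  by rewrite -mulrA -ua mulrA -polyCM mulVr // polyC1 mul1r.
have [p0 _ pP] := polyC_prime pp; have p0' : p != 0 by rewrite -polyC_eq0.
rewrite polyCM -mulrA => bhE.
have : divides p%:P (b * h) by rewrite -bhE; apply: dividesMl.
case/pP => -[d dE].
  have [|b' [h' [sb sh ->]]] := IHc d h.
    by apply: (mulfI p0); rewrite bhE dE mulrA.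
  by exists b', h'; rewrite dE mul_polyC size_scale.
have [|b' [h' [sb sh ->]]] := IHc b d.
  by apply: (mulfI p0); rewrite bhE dE mulrCA.
by exists b', h'; rewrite dE mul_polyC size_scale.
Qed.

Lemma primitive_divides_const c a y t : primitive_poly a -> c != 0 ->
  c%:P * y = a * t -> divides a y.
Proof.
move=> apr c0; move: c c0 t.
apply: (factorial_ind factR) => [u uu|p c pp c0 IHc] t.
  move=> uy; exists (u^-1%:P * t).
  by rewrite mulrCA -uy mulrA -polyCM mulVr // polyC1 mul1r.
have [p0 _ pP] := polyC_prime pp; rewrite polyCM -mulrA => yE.
have : divides p%:P (a * t) by rewrite -yE; apply: dividesMl.
case/pP => [/(apr _ pp)//|[d dE]].
by apply: (IHc d); apply: (mulfI p0); rewrite yE dE mulrCA.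
Qed.

(** A greatest common divisor of a and x over the fraction field is, up to
    [split_const], a factor of a; so it is a constant or associated to a. In the
    first case a divides y over the fraction field, in the second it divides x,
    and for a primitive a divisibility descends to R. *)
Lemma primitive_irreducible_prime a : (1 < size a)%N -> primitive_poly a ->
  (forall b h, a = b * h -> (size b <= 1)%N \/ (size h <= 1)%N) ->
  prime_element a.
Proof.
move=> sa apr airr; have a0 : a != 0 by rewrite -size_poly_gt0 ltnW.
split => // [|x y [z xyE]].
  by rewrite poly_unitE; case: eqP sa => // ->.
have [c c0 [t agt]] : exists2 c, c != 0 & exists t, c%:P * a = gcdp a x * t.
  have /Pdiv.Idomain.dvdpP[[c t] /= c0 e] := dvdp_gcdl a x.
  by exists c => //; exists t; rewrite mul_polyC e mulrC.
have div_of_dvdp y' : a %| y' -> divides a y'.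
  move=> /Pdiv.Idomain.dvdpP[[d t'] /= d0 e].
  by apply: (primitive_divides_const (c := d) (t := t')) => //; rewrite mul_polyC e mulrC.
have [b [h [sb sh abh]]] := split_const c0 agt.
have [sb1|sh1] := airr _ _ abh.
  right; apply: div_of_dvdp; have cop : coprimep a x.
    rewrite coprimep_def -sb eqn_leq sb1 size_poly_gt0.
    by apply: contraNneq a0 => b0; rewrite abh b0 mul0r.
  by rewrite -(Gauss_dvdpr _ cop) xyE dvdp_mulr.
left; apply: div_of_dvdp; apply: dvdp_trans (dvdp_gcdr a x).
have h0 : h != 0 by apply: contraNneq a0 => h0; rewrite abh h0 mulr0.
have b0 : b != 0 by apply: contraNneq a0 => b0; rewrite abh b0 mul0r.
have : gcdp a x %= a.
  rewrite -dvdp_size_eqp ?dvdp_gcdl // -sb abh size_mul //.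
  have -> : size h = 1%N by apply/eqP; rewrite eqn_leq sh1 size_poly_gt0.
  by rewrite addn1.
by rewrite eqp_sym => /andP[].
Qed.

(** The primes that can be extracted from a divide its leading coefficient, which
    bounds their number. *)
Lemma primitive_part a : a != 0 ->
  exists (c : R) (a' : {poly R}), [/\ c != 0, a = c%:P * a' & primitive_poly a'].
Proof.
move=> a0; have : lead_coef a != 0 by rewrite lead_coef_eq0.
case/factR=> u [s [uu sP]]; have [n] := ubnP (size s).
elim: n => // n IHn in a u s uu sP a0 *; rewrite ltnS => le lcE.
have [[p [pp [b aE]]]|npr] := pselect (exists p, prime_element p /\ divides p%:P a);
  last first.
  exists 1, a; rewrite oner_eq0 mul1r; split=> // p pp d; apply: npr.
  by exists p.
have [p0 _ _] := pp; have b0 : b != 0 by apply: contraNneq a0 => b0; rewrite aE b0 mulr0.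
have lcb : u * \prod_(q <- s) q = p * lead_coef b by rewrite -lcE aE lead_coefM lead_coefC.
have [v [r [vu rP ltr lcbE]]] := prime_factored_divide pp uu sP lcb.
have [c [a' [c0 bE a'pr]]] := IHn b v r vu rP b0 (leq_trans ltr le) lcbE.
exists (p * c), a'; split=> //; first by rewrite mulf_neq0.
by rewrite aE bE polyCM mulrA.
Qed.

(** Gauss's theorem. *)
Lemma factorial_poly : factorial_ring {poly R}.
Proof.
move=> a; have [n] := ubnP (size a); elim: n a => // n IHn a; rewrite ltnS => le a0.
have [c [a' [c0 aE a'pr]]] := primitive_part a0.
have a'0 : a' != 0 by apply: contraNneq a0 => a'0; rewrite aE a'0 mulr0.
have sa' : size a' = size a by rewrite aE mul_polyC size_scale.
rewrite aE; apply: prime_factoredM.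
  have [u [s [uu sP cE]]] := factR c0; exists u%:P, (map polyC s); split.
  - have u0 : u != 0 by apply: contraTneq uu => ->; rewrite unitr0.
    by rewrite poly_unitE size_polyC coefC uu u0.
  - by move=> _ /mapP[p /sP pp ->]; apply: polyC_prime.
  - by rewrite big_map cE polyCM rmorph_prod.
have [sz|sz] := leqP (size a') 1.
  have a'C := size1_polyC sz; exists a', [::]; rewrite big_nil mulr1; split=> //.
  have c'0 : a'`_0 != 0 by rewrite -polyC_eq0 -a'C.
  have [u [[|p s] [uu sP c'E]]] := factR c'0.
    rewrite poly_unitE eqn_leq sz size_poly_gt0 a'0.
    by rewrite big_nil mulr1 in c'E; rewrite c'E.
  case: (a'pr p); first by apply: sP; rewrite mem_head.
  rewrite a'C c'E big_cons mulrCA polyCM; exact: dividesMl.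
have [[b [h [abh sb sh]]]|irr] := pselect
  (exists b h : {poly R}, [/\ a' = b * h, (1 < size b)%N & (1 < size h)%N]).
  have b0 : b != 0 by rewrite -size_poly_gt0 ltnW.
  have h0 : h != 0 by rewrite -size_poly_gt0 ltnW.
  have szE : size a = (size b + size h).-1 by rewrite -sa' abh size_mul.
  by rewrite abh; apply: prime_factoredM; apply: IHn => //; lia.
have pa' : prime_element a'.
  apply: primitive_irreducible_prime => // b h abh.
  have [|sb] := leqP (size b) 1; first by left.
  have [|sh] := leqP (size h) 1; first by right.
  by case: irr; exists b, h.
exact: prime_prime_factored.
Qed.
End FactorialPoly.

Lemma factorial_field (k : fieldType) : factorial_ring k.
Proof.
move=> a a0; exists a, [::]; split=> //; first by rewrite unitfE.
by rewrite big_nil mulr1.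
Qed.

(** * Polynomials in three variables as iterated polynomials *)

(** The variables generate the polynomial ring as an algebra. *)
Lemma mpoly_ring_ind (R : comNzRingType) n (P : {mpoly R[n]} -> Prop) :
  (forall c, P c%:MP) -> (forall i, P 'X_i) ->
  (forall f g, P f -> P g -> P (f + g)) ->
  (forall f g, P f -> P g -> P (f * g)) -> forall f, P f.
Proof.
move=> PC PX PD PM f.
have P1 : P 1 by rewrite -mpolyC1; apply: PC.
rewrite (mpolyE f); elim: (msupp f) => [|m s IHs].
  by rewrite big_nil -mpolyC0; apply: PC.
rewrite big_cons; apply: (PD) => //; rewrite -mul_mpolyC; apply: (PM); first exact: PC.
rewrite mpolyXE_id; apply: (big_ind P); [exact: P1 | exact: PM |] => i _.
by elim: (m i) => [|e IHe]; rewrite ?expr0 // exprS; apply: PM.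
Qed.

Lemma eq_mpoly_morphism (R : comNzRingType) n (B : nzRingType)
    (u v : {rmorphism {mpoly R[n]} -> B}) :
  (forall c, u c%:MP = v c%:MP) -> (forall i, u 'X_i = v 'X_i) -> u =1 v.
Proof.
move=> eC eX; elim/mpoly_ring_ind => // f g ef eg.
  by rewrite !rmorphD ef eg.
by rewrite !rmorphM ef eg.
Qed.

Lemma eq_poly_morphism (R : comNzRingType) (B : nzRingType)
    (u v : {rmorphism {poly R} -> B}) :
  (forall c, u c%:P = v c%:P) -> u 'X = v 'X -> u =1 v.
Proof.
move=> eC eX; elim/poly_ind => [|p c IHp]; first by rewrite !rmorph0.
by rewrite !rmorphD !rmorphM /= IHp eX eC.
Qed.

Section PolyEval.
Variables (A B : comNzRingType) (u : {rmorphism A -> B}) (x : B).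

Definition poly_eval : {poly A} -> B := horner_eval x \o map_poly u.
HB.instance Definition _ := GRing.RMorphism.on poly_eval.

Lemma poly_evalC c : poly_eval c%:P = u c.
Proof. by rewrite /poly_eval /= map_polyC /horner_eval hornerC. Qed.
Lemma poly_evalX : poly_eval 'X = x.
Proof. by rewrite /poly_eval /= map_polyX /horner_eval hornerX. Qed.
End PolyEval.

(** The variables i, j and k (any third index) become, in this order, the outer,
    middle and inner variables of R[X_k][X_j][X_i]. *)
Definition nested_var (R : comNzRingType) (i j l : 'I_3) : {poly {poly {poly R}}} :=
  if l == i then 'X else if l == j then 'X%:P else 'X%:P%:P.

(** This function and the next are locked since unfolding them in failing
    conversions is very slow. *)
HB.lock Definition of_nested (R : comNzRingType) (i j k : 'I_3)
    (p : {poly {poly {poly R}}}) : {mpoly R[3]} :=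
  poly_eval (poly_eval (poly_eval (@mpolyC 3 R) 'X_k) 'X_j) 'X_i p.
HB.lock Definition to_nested (R : comNzRingType) (i j : 'I_3) (f : {mpoly R[3]}) :
    {poly {poly {poly R}}} :=
  mmap (polyC \o polyC \o polyC) (nested_var R i j) f.

Section NestedPoly.
Variables (R : comNzRingType) (i j k : 'I_3).
Hypothesis ijk : uniq [:: i; j; k].
Local Notation of_nested := (@of_nested R i j k).
Local Notation to_nested := (@to_nested R i j).
Local Notation nested_var := (@nested_var R i j).

Lemma of_nested_is_zmod_morphism : zmod_morphism of_nested.
Proof. by rewrite of_nested.unlock => p q; rewrite rmorphB. Qed.
Lemma of_nested_is_monoid_morphism : monoid_morphism of_nested.
Proof. by rewrite of_nested.unlock; split=> [|p q]; [apply: rmorph1|apply: rmorphM]. Qed.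
HB.instance Definition _ := GRing.isZmodMorphism.Build _ _ of_nested
  of_nested_is_zmod_morphism.
HB.instance Definition _ := GRing.isMonoidMorphism.Build _ _ of_nested
  of_nested_is_monoid_morphism.

Lemma to_nested_is_zmod_morphism : zmod_morphism to_nested.
Proof. by rewrite to_nested.unlock => p q; rewrite rmorphB. Qed.
Lemma to_nested_is_monoid_morphism : monoid_morphism to_nested.
Proof. by rewrite to_nested.unlock; split=> [|p q]; [apply: rmorph1|apply: rmorphM]. Qed.
HB.instance Definition _ := GRing.isZmodMorphism.Build _ _ to_nested
  to_nested_is_zmod_morphism.
HB.instance Definition _ := GRing.isMonoidMorphism.Build _ _ to_nested
  to_nested_is_monoid_morphism.

Lemma of_nestedC c : of_nested c%:P%:P%:P = c%:MP.
Proof. by rewrite of_nested.unlock; do 3 rewrite [LHS]poly_evalC /=. Qed.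
Lemma of_nested_i : of_nested 'X = 'X_i.
Proof. by rewrite of_nested.unlock poly_evalX. Qed.
Lemma of_nested_j : of_nested 'X%:P = 'X_j.
Proof. by rewrite of_nested.unlock [LHS]poly_evalC /= poly_evalX. Qed.
Lemma of_nested_k : of_nested 'X%:P%:P = 'X_k.
Proof.
by rewrite of_nested.unlock; do 2 rewrite [LHS]poly_evalC /=; rewrite poly_evalX.
Qed.

Lemma ord3_cases (l : 'I_3) : [\/ l = i, l = j | l = k].
Proof.
have : [set x in [:: i; j; k]] == [set: 'I_3].
  by rewrite eqEcard subsetT cardsT card_ord cardsE (card_uniqP ijk).
move=> /eqP/setP/(_ l); rewrite in_setT.
by rewrite !inE => /or3P[] /eqP ->; [constructor 1|constructor 2|constructor 3].
Qed.

Lemma to_nestedC c : to_nested c%:MP = c%:P%:P%:P.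
Proof. by rewrite to_nested.unlock mmapC. Qed.
Lemma to_nestedX l : to_nested 'X_l = nested_var l.
Proof. by rewrite to_nested.unlock mmapX mmap1U. Qed.
Lemma nested_var_i : nested_var i = 'X. Proof. by rewrite /nested_var eqxx. Qed.
Lemma nested_var_j : nested_var j = 'X%:P.
Proof.
by move: ijk; rewrite /nested_var /= !inE eq_sym eqxx negb_or
  => /andP[/andP[/negPf -> _] _].
Qed.
Lemma nested_var_k : nested_var k = 'X%:P%:P.
Proof.
move: ijk; rewrite /nested_var /= !inE [k == i]eq_sym [k == j]eq_sym negb_or.
by move=> /and3P[/andP[_ /negPf ->] /negPf -> _].
Qed.

Lemma to_nestedK : cancel to_nested of_nested.
Proof.
apply: (@eq_mpoly_morphism R 3 {mpoly R[3]} (of_nested \o to_nested) idfun) => [c|l] /=.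
  by rewrite to_nestedC of_nestedC.
rewrite to_nestedX; case: (ord3_cases l) => ->.
- by rewrite nested_var_i of_nested_i.
- by rewrite nested_var_j of_nested_j.
- by rewrite nested_var_k of_nested_k.
Qed.

Lemma of_nestedK : cancel of_nested to_nested.
Proof.
apply: (@eq_poly_morphism _ _ (to_nested \o of_nested) idfun) => [p|] /=; last first.
  by rewrite of_nested_i to_nestedX nested_var_i.
move: p; apply: (@eq_poly_morphism _ _ (to_nested \o of_nested \o polyC) polyC) => [p|] /=;
  last first.
  by rewrite of_nested_j to_nestedX nested_var_j.
move: p; apply: (@eq_poly_morphism _ _ (to_nested \o of_nested \o polyC \o polyC)
  (polyC \o polyC)) => [c|] /=; last first.
  by rewrite of_nested_k to_nestedX nested_var_k.
by rewrite of_nestedC to_nestedC.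
Qed.

Lemma to_nested_deriv f : to_nested f^`M(i) = (to_nested f)^`().
Proof.
elim/mpoly_ring_ind: f => [c|l|f g ef eg|f g ef eg].
- by rewrite mderivC rmorph0 to_nestedC derivC.
- rewrite mderivX mnm1E to_nestedX; case: (eqVneq l i) => [->|li].
    by rewrite scale1r nested_var_i derivX -{1}[U_(i)%MM]add0m addmK mpolyX0 rmorph1.
  rewrite scale0r rmorph0; case: (ord3_cases l) li => -> //; first by rewrite eqxx.
    by rewrite nested_var_j derivC.
  by rewrite nested_var_k derivC.
- by rewrite mderivD !rmorphD /= ef eg derivD.
- by rewrite mderivM !rmorphD !rmorphM /= ef eg derivM.
Qed.
End NestedPoly.

Section Transport.
Variables (A B : comUnitRingType) (u : {rmorphism A -> B}) (v : {rmorphism B -> A}).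
Hypotheses (uK : cancel u v) (vK : cancel v u).

Lemma unit_transport p : u p \is a GRing.unit -> p \is a GRing.unit.
Proof. by move=> /(rmorph_unit v); rewrite uK. Qed.

Lemma prime_transport p : prime_element p -> prime_element (u p).
Proof.
move=> [p0 pNu pP]; split.
- by apply: contraNneq p0 => up0; rewrite -(uK p) up0 rmorph0.
- by apply: contraNN pNu => /(rmorph_unit v); rewrite uK.
move=> a b [c abE]; have : divides p (v a * v b).
  by exists (v c); rewrite -rmorphM abE rmorphM uK.
by case/pP => -[d dE]; [left | right]; exists (u d); rewrite -rmorphM -dE vK.
Qed.

Lemma factorial_transport : factorial_ring A -> factorial_ring B.
Proof.
move=> factA b b0; have va0 : v b != 0.
  by apply: contraNneq b0 => vb0; rewrite -(vK b) vb0 rmorph0.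
have [w [s [wu sP vbE]]] := factA _ va0; exists (u w), (map u s); split.
- exact: rmorph_unit.
- by move=> _ /mapP[p /sP pp ->]; apply: prime_transport.
- by rewrite big_map -(vK b) vbE rmorphM rmorph_prod.
Qed.
End Transport.

Lemma uniq_ord3 : uniq [:: 0; 1; 2 : 'I_3]. Proof. by []. Qed.

Lemma factorial_mpoly3 (R : idomainType) : factorial_ring R -> factorial_ring {mpoly R[3]}.
Proof.
move=> factR; pose K := @of_nestedK R 0 1 2 uniq_ord3.
apply: (factorial_transport K (to_nestedK uniq_ord3)).
by do 3 apply: factorial_poly.
Qed.

Lemma mpolyC_prime (R : idomainType) (p : R) : prime_element p ->
  prime_element (p%:MP_[3]).
Proof.
move=> pp; rewrite -(of_nestedC 0 1 2).
pose K := @of_nestedK R 0 1 2 uniq_ord3.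
apply: (prime_transport K (to_nestedK uniq_ord3)).
by do 3 apply: polyC_prime.
Qed.

(** A polynomial of degree one is prime to the constants over the fraction field,
    and the denominators in a division by it are powers of its leading
    coefficient. *)
Lemma linear_poly_pseudo_divides (B : idomainType) (a d c : B) (g h : {poly B}) :
  a != 0 -> c != 0 -> g * (a%:P * 'X - d%:P) = h * c%:P ->
  exists n q, (a ^+ n)%:P * h = q * (a%:P * 'X - d%:P).
Proof.
move=> a0 c0; set e := _ - _ => ghE.
have lce : lead_coef e = a.
  rewrite /e -polyCN lead_coefDl ?lead_coefM ?lead_coefC ?lead_coefX ?mulr1 //.
  by rewrite size_mulX ?polyC_eq0 // (size_polyC a) a0 (leq_ltn_trans (size_polyC_leq1 _)).
have : e %| h by rewrite -(dvdpZr _ _ c0) -mul_polyC mulrC -ghE dvdp_mull.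
rewrite Pdiv.Idomain.dvdp_eq lce => /eqP HE.
by exists (scalp h e), (h %/ e); rewrite -HE mul_polyC.
Qed.

(** An instance of [linear_poly_pseudo_divides]: polynomials in the outer variable
    X_i, with a X_j - c X_k as the constant. *)
Lemma linear_form_pseudo_divides (R : idomainType) (i j k : 'I_3) (a b c : R)
   (g h : {mpoly R[3]}) : uniq [:: i; j; k] -> a != 0 ->
  g * (a%:MP * 'X_i - b%:MP * 'X_k) = h * (a%:MP * 'X_j - c%:MP * 'X_k) ->
  exists n q, (a ^+ n)%:MP * h = q * (a%:MP * 'X_i - b%:MP * 'X_k).
Proof.
move=> ijk a0 /(congr1 (@to_nested R i j)).
rewrite !rmorphM !rmorphB !rmorphM /= !to_nestedC !to_nestedX.
rewrite nested_var_i (nested_var_j _ ijk) (nested_var_k _ ijk).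
rewrite -!polyCM -!polyCB.
have D0 : a%:P%:P * 'X - (c%:P * 'X)%:P != 0 :> {poly {poly R}}.
  by rewrite -size_poly_eq0 -polyCN size_MXaddC !polyC_eq0 (negPf a0).
have aP0 : a%:P%:P != 0 :> {poly {poly R}} by rewrite !polyC_eq0.
move=> /(linear_poly_pseudo_divides aP0 D0)[n [q qE]].
have [r rE] : exists r, to_nested i j r = q by exists (of_nested i j k q);
  apply: of_nestedK.
exists n, r; apply: (can_inj (to_nestedK ijk)); rewrite !rmorphM rmorphB !rmorphM /=.
rewrite !to_nestedC !to_nestedX nested_var_i (nested_var_k _ ijk) -!polyCM.
by rewrite rE -qE -!polyC_exp.
Qed.

(** * Sums over three indices and substitution in polynomials *)

Lemma ord3_complete (k : 'I_3) : exists i j, uniq [:: i; j; k].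
Proof.
case: k => [[|[|[|//]]] lt].
- by exists 1, 2.
- by exists 0, 2.
- by exists 0, 1.
Qed.

Lemma sum_ord3 (V : nmodType) (F : 'I_3 -> V) (i j k : 'I_3) :
  uniq [:: i; j; k] -> \sum_l F l = F i + F j + F k.
Proof.
move=> ijk; rewrite (eq_bigl (mem [:: i; j; k])) => [|l].
  by rewrite -big_uniq //= !big_cons big_nil addr0 addrA.
by case: (ord3_cases ijk l) => ->; rewrite !inE eqxx ?orbT.
Qed.

Section Subst.
Variables (A : comNzRingType) (n : nat) (B : comNzRingType) (u : {rmorphism A -> B}).
Implicit Types (F : {mpoly A[n]}) (P Q : 'I_n -> B).

(** I is a bare predicate since this is used for ideals given by formulas and for
    divisibility alike. *)
Lemma mmap_congr (I : B -> Prop) P Q F :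
  I 0 -> (forall a b, I a -> I b -> I (a + b)) -> (forall a b, I b -> I (a * b)) ->
  (forall l, I (P l - Q l)) -> I (mmap u P F - mmap u Q F).
Proof.
move=> I0 ID IM PQ; elim/mpoly_ring_ind: F => [c|l|F G IF IG|F G IF IG].
- by rewrite !mmapC subrr.
- by rewrite !mmapX !mmap1U.
- by rewrite !rmorphD opprD addrACA; apply: (ID).
- rewrite !rmorphM /=; set x := mmap _ _ _ in IF *; set y := mmap _ _ _ in IF *.
  set z := mmap _ _ _ in IG *; set t := mmap _ _ _ in IG *.
  have -> : x * z - y * t = z * (x - y) + y * (z - t) by ring.
  by apply: (ID); apply: (IM).
Qed.

Lemma mmap_homog (d : nat) (s : B) P F : F \is d.-homog ->
  mmap u (fun l => s * P l) F = s ^+ d * mmap u P F.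
Proof.
move=> /dhomogP Fd; rewrite /mmap mulr_sumr big_seq [RHS]big_seq.
apply: eq_bigr => m /Fd /= md; rewrite mulrCA; congr (_ * _).
rewrite /mmap1; under eq_bigr do rewrite exprMn.
by rewrite big_split /= -{1}md mdegE -prodrXr.
Qed.
End Subst.

(** * Syzygies of a vector together with the vector of variables *)

Section Relations.
Variables (A : idomainType).
Local Notation S := {mpoly A[3]}.
Implicit Types (f a : 'I_3 -> A) (F G H : S) (alpha : 'I_3 -> S).

Lemma divides_mcoeff (p : A) F m : divides p%:MP F -> divides p F@_m.
Proof. by move=> [G ->]; exists G@_m; rewrite mcoeffCM. Qed.

Lemma divides_binomial (p b c : A) (j k : 'I_3) : j != k ->
  divides p%:MP (b%:MP * 'X_j - c%:MP * 'X_k : S) -> divides p b /\ divides p c.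
Proof.
move=> jk d; split.
  have := divides_mcoeff U_(j) d; rewrite mcoeffB !mcoeffCM !mcoeffX.
  by rewrite eqxx eq_mnm1 [k == j]eq_sym (negPf jk) mulr1 mulr0 subr0.
have := divides_mcoeff U_(k) d; rewrite mcoeffB !mcoeffCM !mcoeffX.
rewrite eqxx eq_mnm1 (negPf jk) mulr1 mulr0 sub0r => /dividesN.
by rewrite opprK.
Qed.

Definition primitive_family f :=
  forall p, prime_element p -> ~ forall l, divides p (f l).

Hypothesis factA : factorial_ring A.

(** The primes that can be extracted from all the f l divide a fixed nonzero one
    of them, which bounds their number. *)
Lemma primitive_family_factor f : (exists k, f k != 0) ->
  exists e g, [/\ e != 0, forall l, f l = e * g l & primitive_family g].
Proof.
move=> [k fk0]; have [u [s [uu sP fkE]]] := factA fk0.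
have [n] := ubnP (size s); elim: n => // n IHn in f u s uu sP fk0 fkE *.
rewrite ltnS => le.
have [[p [pp pf]]|npr] := pselect (exists p, prime_element p /\ forall l, divides p (f l));
  last first.
  exists 1, f; split=> // [|l|p pp d]; rewrite ?oner_eq0 ?mul1r //.
  by apply: npr; exists p.
have [g fE] := choice pf; have [p0 _ _] := pp.
have gkE : u * \prod_(q <- s) q = p * g k by rewrite -fkE fE.
have gk0 : g k != 0 by apply: contraNneq fk0 => gk0; rewrite fE gk0 mulr0.
have [v [r [vu rP ltr gE]]] := prime_factored_divide pp uu sP gkE.
have [e [h [e0 ghE hP]]] := IHn g v r vu rP gk0 gE (leq_trans ltr le).
exists (p * e), h; split=> // [|l]; first by rewrite mulf_neq0.
by rewrite fE ghE mulrA.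
Qed.

(** A prime of s divides h, since it divides all h * c l but not all c l. *)
Lemma primitive_proportional (c g : 'I_3 -> S) (s : A) h : s != 0 ->
  (forall p : A, prime_element p -> ~ forall l, divides p%:MP (c l)) ->
  (forall l, s%:MP * g l = h * c l) -> exists h', forall l, g l = h' * c l.
Proof.
move=> s0 cprim; move: s s0 h.
apply: (factorial_ind factA) => [u uu|p s pp s0 IHs] h gh.
  exists (u^-1%:MP * h) => l.
  by rewrite -mulrA -gh mulrA -mpolyCM mulVr // mpolyC1 mul1r.
have [p0 _ pP] := mpolyC_prime pp.
have [h' hE] : divides p%:MP h.
  have [l nd] : exists l, ~ divides p%:MP (c l) by apply/existsNP/(cprim _ pp).
  have : divides p%:MP (h * c l) by rewrite -gh mpolyCM -mulrA; apply: dividesMl.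
  by case/pP.
apply: (IHs h') => l; apply: (mulfI p0).
by rewrite mulrA -mpolyCM gh hE mulrA.
Qed.

(** The vector c is the cross product of f and T. Over the fraction field of S
    every g orthogonal to f and T is a multiple of c. With f k nonzero, the
    equation g i c_j = g j c_i between linear forms in T_i and in T_j shows that
    a power of f k is a sufficient denominator, and as no prime of A divides all
    entries of c this denominator cancels. *)
Lemma cross_product_generates f : (exists k, f k != 0) -> primitive_family f ->
  exists c : 'I_3 -> S,
    [/\ exists l, c l != 0, \sum_l c l * 'X_l = 0, \sum_l c l * (f l)%:MP = 0 &
     forall g, \sum_l g l * 'X_l = 0 -> \sum_l g l * (f l)%:MP = 0 ->
       exists h, forall l, g l = h * c l].
Proof.
move=> [k fk0] fprim; have [i [j ijk]] := ord3_complete k.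
have [ij ik jk] : [/\ i != j, i != k & j != k].
  by move: ijk; rewrite /= !inE negb_or => /and3P[/andP[]].
have S3 (F : 'I_3 -> S) : \sum_l F l = F i + F j + F k := sum_ord3 F ijk.
pose c l : S := if l == i then (f j)%:MP * 'X_k - (f k)%:MP * 'X_j
  else if l == j then (f k)%:MP * 'X_i - (f i)%:MP * 'X_k
  else (f i)%:MP * 'X_j - (f j)%:MP * 'X_i.
have ci : c i = (f j)%:MP * 'X_k - (f k)%:MP * 'X_j by rewrite /c eqxx.
have cj : c j = (f k)%:MP * 'X_i - (f i)%:MP * 'X_k.
  by rewrite /c eqxx eq_sym (negPf ij).
have ck : c k = (f i)%:MP * 'X_j - (f j)%:MP * 'X_i.
  by rewrite /c ![k == _]eq_sym (negPf ik) (negPf jk).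
have fk0' : (f k)%:MP_[3] != 0 by rewrite mpolyC_eq0.
exists c; split.
- exists j; rewrite cj; apply/eqP => /(congr1 (mcoeff U_(i)))/eqP.
  rewrite mcoeffB !mcoeffCM !mcoeffX mcoeff0 eqxx eq_mnm1 [k == i]eq_sym (negPf ik).
  by rewrite mulr1 mulr0 subr0 (negPf fk0).
- by rewrite S3 ci cj ck; ring.
- by rewrite S3 ci cj ck; ring.
move=> g; rewrite !S3 => gT gf.
have gk : (f k)%:MP * g k = - ((f i)%:MP * g i) - (f j)%:MP * g j.
  by apply/eqP; rewrite -subr_eq0 -[X in _ == X]gf; apply/eqP; ring.
have gij : g i * ((f k)%:MP * 'X_i - (f i)%:MP * 'X_k) =
    - g j * ((f k)%:MP * 'X_j - (f j)%:MP * 'X_k).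
  apply/eqP; rewrite -subr_eq0; apply/eqP.
  transitivity ((f k)%:MP * (g i * 'X_i + g j * 'X_j + g k * 'X_k)
    - 'X_k * ((f i)%:MP * g i + (f j)%:MP * g j + (f k)%:MP * g k)); first by ring.
  by rewrite gT gk; ring.
have [n [q]] := linear_form_pseudo_divides ijk fk0 gij.
rewrite mulrN -cj => /(congr1 -%R); rewrite opprK -mulNr; set h := - q => gjE.
have cj0 : c j != 0.
  apply/eqP; rewrite cj => /(congr1 (mcoeff U_(i)))/eqP.
  rewrite mcoeffB !mcoeffCM !mcoeffX mcoeff0 eqxx eq_mnm1 [k == i]eq_sym (negPf ik).
  by rewrite mulr1 mulr0 subr0 (negPf fk0).
have giE : (f k ^+ n)%:MP * g i = h * c i.
  apply: (mulIf cj0); rewrite -mulrA {1}cj gij.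
  by transitivity ((f k ^+ n)%:MP * g j * c i); [rewrite ci | rewrite gjE]; ring.
have gkE : (f k ^+ n)%:MP * g k = h * c k.
  apply: (mulfI fk0'); rewrite mulrCA gk mulrBr mulrN mulrCA giE [X in _ - X]mulrCA gjE.
  by rewrite ci cj ck; ring.
apply: (@primitive_proportional c g (f k ^+ n) h).
- by rewrite expf_neq0.
- move=> p pp d; apply: (fprim p pp).
  have [dj dk] : divides p (f j) /\ divides p (f k).
    by apply: (divides_binomial (j := k) (k := j)); rewrite 1?eq_sym // -ci.
  have [_ di] : divides p (f k) /\ divides p (f i).
    by apply: (divides_binomial ik); rewrite -cj.
  by move=> l; case: (ord3_cases ijk l) => ->.
- by move=> l; case: (ord3_cases ijk l) => ->.
Qed.
End Relations.

(** * The ideal of linear relations *)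

Section LinearRelations.
Variables (A : idomainType) (f : 'I_3 -> A).
Local Notation S := {mpoly A[3]}.
Implicit Types (a : 'I_3 -> A) (F G H : S) (alpha : 'I_3 -> S).

(** The ideal of S generated by the linear forms in T whose coefficients are a
    syzygy of f. The coefficient alpha l ranges over S, which makes the closure
    under multiplication immediate. *)
Definition linear_relation F := exists2 alpha : 'I_3 -> S,
  \sum_l alpha l * (f l)%:MP = 0 & F = \sum_l alpha l * 'X_l.

Lemma linear_relation0 : linear_relation 0.
Proof. by exists (fun=> 0); rewrite big1 // => l _; rewrite mul0r. Qed.

Lemma linear_relationD F G :
  linear_relation F -> linear_relation G -> linear_relation (F + G).
Proof.
move=> [al alf ->] [be bef ->]; exists (fun l => al l + be l).
  by under eq_bigr do rewrite mulrDl; rewrite big_split /= alf bef addr0.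
by rewrite -big_split; apply: eq_bigr => l _; rewrite mulrDl.
Qed.

Lemma linear_relationM F G : linear_relation G -> linear_relation (F * G).
Proof.
move=> [al alf ->]; exists (fun l => F * al l).
  by under eq_bigr do rewrite -mulrA; rewrite -mulr_sumr alf mulr0.
by rewrite mulr_sumr; apply: eq_bigr => l _; rewrite mulrA.
Qed.

Lemma syzygy_linear_relation a : \sum_l a l * f l = 0 ->
  linear_relation (\sum_l (a l)%:MP * 'X_l).
Proof.
move=> af; exists (fun l => (a l)%:MP) => //.
by under eq_bigr do rewrite -mpolyCM; rewrite -rmorph_sum /= af.
Qed.

Hypothesis factA : factorial_ring A.

(** By induction on the primes of s. Each of them divides H, or else it divides b
    and c, and the relation between b and c survives the division. In the end s
    is a unit, and b T_j - c T_k is a linear relation. Starting from b = f_k and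
    c = f_j, this replaces the division by the greatest common divisor of f_j
    and f_k. *)
Lemma linear_relation_cancel (s : A) G H (b c : A) (j k : 'I_3) :
  s != 0 -> j != k -> b * f j = c * f k ->
  s%:MP * G = (b%:MP * 'X_j - c%:MP * 'X_k) * H -> linear_relation G.
Proof.
move=> s0 jk; move: s s0 b c H.
apply: (factorial_ind factA) => [u uu|p s pp s0 IHs] b c H bc sG.
  have -> : G = (u^-1%:MP * H) * (b%:MP * 'X_j - c%:MP * 'X_k).
    by rewrite -mulrA [H * _]mulrC -sG mulrA -mpolyCM mulVr // mpolyC1 mul1r.
  apply: linear_relationM.
  pose al l : S := if l == j then b%:MP else if l == k then - c%:MP else 0.
  have alE (E : 'I_3 -> S) : \sum_l al l * E l = b%:MP * E j - c%:MP * E k.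
    rewrite (bigD1 j) //= (bigD1 k) 1?eq_sym //= /al eqxx eq_sym (negPf jk) eqxx.
    rewrite big1 ?addr0 => [|l /andP[/negPf-> /negPf->]]; last by rewrite mul0r.
    by rewrite mulNr.
  by exists al; rewrite alE // -!mpolyCM bc subrr.
have [p0 _ pP] := mpolyC_prime pp; have p0' : p != 0 by rewrite -(mpolyC_eq0 3).
have [d|[H' HE]] : divides p%:MP (b%:MP * 'X_j - c%:MP * 'X_k : S) \/ divides p%:MP H.
- by apply: pP; rewrite -sG mpolyCM -mulrA; apply: dividesMl.
- have [[b' bE] [c' cE]] := divides_binomial jk d; apply: (IHs b' c' H).
    by apply: (mulfI p0'); rewrite !mulrA -bE -cE.
  by apply: (mulfI p0); rewrite mulrA -mpolyCM sG bE cE !mpolyCM; ring.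
apply: (IHs b c H' bc).
by apply: (mulfI p0); rewrite mulrA -mpolyCM sG HE mulrCA.
Qed.

Local Notation subst P F := (mmap (@mpolyC 3 A) P F).

Lemma subst_var F : subst (fun l => 'X_l) F = F.
Proof.
apply: (@eq_mpoly_morphism A 3 S (mmap (@mpolyC 3 A) (fun l => 'X_l)) idfun) => [c|l] /=.
  by rewrite mmapC.
by rewrite mmapX mmap1U.
Qed.

Lemma subst_meval F : subst (fun l => (f l)%:MP) F = (F.@[f])%:MP.
Proof.
apply: (@eq_mpoly_morphism A 3 S (mmap (@mpolyC 3 A) _) (@mpolyC 3 A \o meval f))
  => [c|l] /=.
  by rewrite mmapC mevalC.
by rewrite mmapX mmap1U mevalXU.
Qed.

(** Modulo the relation given by the syzygy a, one has
    a_i T_i = - (a_j T_j + a_k T_k); so a_i ^ d F is congruent to a form in T_j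
    and T_k, namely F at tau. If f k is nonzero, then f_k ^ d times it is, modulo
    f_k T_j - f_j T_k, the value of F at a multiple of f, which vanishes. *)
Lemma syzygy_entry_power a d F i : (exists k, f k != 0) ->
  \sum_l a l * f l = 0 -> F \is d.-homog -> F.@[f] = 0 ->
  linear_relation ((a i ^+ d)%:MP * F).
Proof.
move=> fn0 af Fd Ff.
have [ai0|ai0] := eqVneq (a i) 0.
  case: d => [|d] in Fd *; last first.
    by rewrite ai0 expr0n mpolyC0 mul0r; apply: linear_relation0.
  have F0 : F = (F@_0)%:MP.
    apply: msize1_polyC; rewrite msizeE; apply/bigmax_leqP_seq => m mF _.
    by by move/dhomogP: Fd => /(_ m mF) /= ->.
  move: Ff; rewrite F0 mevalC => ->.
  by rewrite mpolyC0 mulr0; apply: linear_relation0.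
have [j [k jki]] := ord3_complete i.
have A3 (E : 'I_3 -> A) : \sum_l E l = E j + E k + E i := sum_ord3 E jki.
have S3 (E : 'I_3 -> S) : \sum_l E l = E j + E k + E i := sum_ord3 E jki.
have [jk [ji ki]] : j != k /\ j != i /\ k != i.
  by move: jki; rewrite /= !inE negb_or => /and3P[/andP[]].
(* If f_j = f_k = 0, then a_i f_i = 0 with a_i nonzero, and f = 0. *)
wlog fk0 : j k jki A3 S3 jk ji ki / f k != 0.
  move=> wl; have [fk0|fk0] := eqVneq (f k) 0; last exact: (wl j k).
  have [fj0|fj0] := eqVneq (f j) 0; last first.
    apply: (wl k j) => //; first by rewrite /= !inE negb_or eq_sym jk ki ji.
    - by move=> E; rewrite A3; ring.
    - by move=> E; rewrite S3; ring.
    - by rewrite eq_sym.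
  case: fn0 => l /eqP[]; move/eqP: af; rewrite A3 fj0 fk0 !mulr0 !add0r mulf_eq0.
  rewrite (negPf ai0) /= => /eqP fi0.
  by case: (ord3_cases jki l) => ->.
pose tau l : S := if l == i then - ((a j)%:MP * 'X_j + (a k)%:MP * 'X_k)
  else (a i)%:MP * 'X_l.
have cong : linear_relation ((a i ^+ d)%:MP * F - subst tau F).
  rewrite -{1}(subst_var F) rmorphXn -mmap_homog //.
  apply: mmap_congr => [|||l]; [exact: linear_relation0
    |exact: linear_relationD|exact: linear_relationM|].
  rewrite /tau; case: eqP => [->|_]; last by rewrite subrr; apply: linear_relation0.
  have := syzygy_linear_relation af; rewrite S3; congr linear_relation; ring.
have tauF : linear_relation (subst tau F).
  have [H HE] : divides ((f k)%:MP * 'X_j - (f j)%:MP * 'X_k : S)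
    ((f k ^+ d)%:MP * subst tau F).
    rewrite rmorphXn -mmap_homog //.
    have -> : subst (fun l => (f k)%:MP * tau l) F = subst (fun l => (f k)%:MP * tau l) F -
       subst (fun l => (a i)%:MP * 'X_k * (f l)%:MP) F.
      by rewrite [X in _ - X](mmap_homog _ _ _ Fd) subst_meval Ff mpolyC0 mulr0 subr0.
    apply: mmap_congr => [|||l]; [exact: divides0|exact: dividesD|exact: divides_mull|].
    rewrite /tau; case: (ord3_cases jki l) => ->; rewrite ?eqxx ?(negPf ji) ?(negPf ki).
    - by exists ((a i)%:MP); ring.
    - by exists 0; ring.
    exists (- (a j)%:MP).
    have : (a j)%:MP * (f j)%:MP + (a k)%:MP * (f k)%:MP + (a i)%:MP * (f i)%:MP = 0 :> S.
      by move: af; rewrite A3 -!mpolyCM -!mpolyCD => ->.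
    move=> e; apply/eqP; rewrite -subr_eq0; apply/eqP.
    by rewrite -[RHS](mulr0 (- 'X_k)) -e; ring.
  by apply: (linear_relation_cancel _ jk _ HE); rewrite ?expf_neq0 // mulrC.
by rewrite -[X in linear_relation X](subrK (subst tau F)); apply: linear_relationD.
Qed.

Variables (x y z : A).
Hypotheses (x0 : x != 0).
Hypotheses (xy_reg : forall s t : S, x%:MP * s = y%:MP * t -> exists r, t = x%:MP * r).
Hypotheses (xyz_reg : forall r s t : S, z%:MP * r = x%:MP * s + y%:MP * t ->
  exists s' t', r = x%:MP * s' + y%:MP * t').

(** The class of F yields a cocycle in the Koszul complex of x, y, z: if x F, y F
    and z F come from the vectors al, be and de, then the three combinations such
    as y al - x be are orthogonal to f and T. So they are multiples h3 c, h1 c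
    and h2 c of the cross product c, with z h3 + x h1 + y h2 = 0. Hence h3 lies
    in (x, y), and al can be corrected by a multiple of c so as to become
    divisible by x. *)
Lemma linear_relation_socle F : (exists k, f k != 0) -> primitive_family f ->
  linear_relation (x%:MP * F) -> linear_relation (y%:MP * F) ->
  linear_relation (z%:MP * F) -> linear_relation F.
Proof.
move=> fn0 fprim [al alf xF] [be bef yF] [de def zF].
have [c [[l0 cl0] cT cf cgen]] := cross_product_generates factA fn0 fprim.
have lin (u v : S) (g h E : 'I_3 -> S) :
    \sum_l (u * g l - v * h l) * E l = u * (\sum_l g l * E l) - v * (\sum_l h l * E l).
  rewrite !mulr_sumr -sumrB; apply: eq_bigr => l _; ring.
have koszul (u v : A) g h : \sum_l g l * (f l)%:MP = 0 -> \sum_l h l * (f l)%:MP = 0 ->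
    u%:MP * F = \sum_l g l * 'X_l -> v%:MP * F = \sum_l h l * 'X_l ->
    exists r, forall l, v%:MP * g l - u%:MP * h l = r * c l.
  move=> gf hf gF hF; apply: cgen; rewrite lin.
    by rewrite -gF -hF; ring.
  by rewrite gf hf !mulr0 subrr.
have [h3 h3E] := koszul _ _ _ _ alf bef xF yF.
have [h1 h1E] := koszul _ _ _ _ bef def yF zF.
have [h2 h2E] := koszul _ _ _ _ def alf zF xF.
have [s [t h3st]] : exists s t, h3 = x%:MP * s + y%:MP * t.
  apply: (xyz_reg (s := - h1) (t := - h2)); apply: (mulIf cl0).
  rewrite -mulrA -h3E mulrDl -!mulrA !mulNr -h1E -h2E; ring.
have /choice[r rE] : forall l, exists r, al l - t * c l = x%:MP * r.
  move=> l.
  apply: (xy_reg (s := be l + s * c l)).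
  have := h3E l; rewrite h3st => e; apply/eqP; rewrite -subr_eq0; apply/eqP.
  transitivity (x%:MP * s * c l + y%:MP * t * c l - (y%:MP * al l - x%:MP * be l));
    first by ring.
  by rewrite e; ring.
have x0' : x%:MP_[3] != 0 by rewrite mpolyC_eq0.
have alE l : al l = x%:MP * r l + t * c l by rewrite -rE subrK.
have alsum (E : 'I_3 -> S) : \sum_l c l * E l = 0 ->
    \sum_l al l * E l = x%:MP * \sum_l r l * E l.
  move=> cE; transitivity (x%:MP * (\sum_l r l * E l) + t * (\sum_l c l * E l)).
    by rewrite !mulr_sumr -big_split; apply: eq_bigr => l _; rewrite alE /=; ring.
  by rewrite cE mulr0 addr0.
exists r; apply: (mulfI x0'); first by rewrite mulr0 -alsum.
by rewrite -alsum.
Qed.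

(** By induction on the sum of the exponents, which the product of F by a variable
    decreases, only the case of exponents equal to one is left. *)
Lemma linear_relation_saturated F m n p : (exists k, f k != 0) -> primitive_family f ->
  linear_relation ((x ^+ m)%:MP * F) -> linear_relation ((y ^+ n)%:MP * F) ->
  linear_relation ((z ^+ p)%:MP * F) -> linear_relation F.
Proof.
move=> fn0 fprim; have [N] := ubnP (m + n + p).
elim: N => // N IHN in F m n p *; rewrite ltnS => le.
have unit G : linear_relation (1%:MP * G) -> linear_relation G by rewrite mpolyC1 mul1r.
case: m => [|m] in le *; first by rewrite expr0 => /unit.
case: n => [|n] in le *; first by rewrite expr0 => _ /unit.
case: p => [|p] in le *; first by rewrite expr0 => _ _ /unit.
have shift u (v : A) e : linear_relation ((v ^+ e)%:MP * F) -> linear_relation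
  ((v ^+ e)%:MP * (u * F)).
  by rewrite mulrCA; apply: linear_relationM.
move=> xF yF zF; apply: linear_relation_socle => //.
- apply: (IHN _ m n.+1 p.+1); try exact: shift; first by lia.
  by rewrite mulrA -mpolyCM -exprSr.
- apply: (IHN _ m.+1 n p.+1); try exact: shift; first by lia.
  by rewrite mulrA -mpolyCM -exprSr.
- apply: (IHN _ m.+1 n.+1 p); try exact: shift; first by lia.
  by rewrite mulrA -mpolyCM -exprSr.
Qed.
End LinearRelations.

(** * The symmetric algebra and the criterion for linear type *)

Section SymPresentation.
Variables (A : idomainType) (f : 'I_3 -> A).
Local Notation S := {mpoly A[3]}.
Implicit Types F G : S.

(** Sends T_i to the class of the generator f_i. *)
Definition sym_presentation : S -> sym (ideal f) :=
  mmap (in_alg (sym (ideal f))) (fun i => sym_in (ideal_gen f i)).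
HB.instance Definition _ := GRing.RMorphism.on sym_presentation.

Lemma sym_presentation_surj s : exists F, s = sym_presentation F.
Proof.
elim/sym_ind: s => [a|u|_ _ [F ->] [G ->]|_ _ [F ->] [G ->]].
- by exists a%:MP; rewrite /sym_presentation mmapC.
- have /asboolP[c uE] := valP u.
  exists (\sum_i (c i)%:MP * 'X_i); rewrite rmorph_sum /=.
  have -> : u = \sum_i c i *: ideal_gen f i.
    by apply: val_inj; rewrite raddf_sum uE; apply: eq_bigr.
  rewrite linear_sum; apply: eq_bigr => i _.
  rewrite linearZ rmorphM /= /sym_presentation mmapC mmapX mmap1U.
  by rewrite mulr_algl.
- by exists (F + G); rewrite rmorphD.
- by exists (F * G); rewrite rmorphM.
Qed.

(** The coefficients of a monomial in T in the vector alpha are a syzygy over A;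
    so the classes of the generators satisfy the corresponding relation in the
    symmetric algebra. *)
Lemma sym_presentation_relation F : linear_relation f F -> sym_presentation F = 0.
Proof.
move=> [al alf ->].
pose N := (\max_l msize (al l))%N.
have alE l : al l = \sum_(m : 'X_{1..3 < N}) (al l)@_m *: 'X_[m].
  by apply: mpolywE; apply: (leq_bigmax l).
transitivity (\sum_(m : 'X_{1..3 < N}) sym_presentation 'X_[m] *
    sym_in (\sum_l (al l)@_m *: ideal_gen f l)).
  rewrite rmorph_sum; under [RHS]eq_bigr do rewrite linear_sum mulr_sumr.
  rewrite exchange_big; apply: eq_bigr => l _.
  rewrite rmorphM /= {1}(alE l) rmorph_sum mulr_suml; apply: eq_bigr => m _.
  rewrite -mul_mpolyC rmorphM linearZ /= [sym_presentation _%:MP]mmapC.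
  rewrite [sym_presentation 'X_l]mmapX mmap1U /=.
  by rewrite mulr_algl -scalerAl -scalerAr.
apply: big1 => m _; have -> : \sum_l (al l)@_m *: ideal_gen f l = 0.
  apply: val_inj; rewrite raddf_sum raddf0 /=.
  have := congr1 (mcoeff m) alf; rewrite mcoeff0 raddf_sum /= => {2}<-.
  by apply: eq_bigr => l _; rewrite mulrC mcoeffCM mulrC.
by rewrite linear0 mulr0.
Qed.

Lemma sym_to_poly_presentation F : sym_to_poly (sym_presentation F) =
  mmap polyC (fun i => 'X * (f i)%:P) F.
Proof.
apply: (@eq_mpoly_morphism A 3 {poly A} (sym_lift (ideal_shift (f:=f)) \o sym_presentation)
  (mmap polyC (fun i => 'X * (f i)%:P))) => [a|i] /=.
  rewrite /sym_presentation !mmapC /= linearZ rmorph1 /=.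
  by rewrite -mul_polyC mulr1.
by rewrite /sym_presentation !mmapX !mmap1U /= sym_lift_in /ideal_shift mulrC.
Qed.

(** On forms of degree d the natural map is F |-> F(f) t ^ d. *)
Lemma sym_to_poly_coef F d :
  (sym_to_poly (sym_presentation F))`_d = (pihomog mdeg d F).@[f].
Proof.
rewrite sym_to_poly_presentation.
have hom e : mmap polyC (fun i => 'X * (f i)%:P) (pihomog mdeg e F) =
    'X^e * ((pihomog mdeg e F).@[f])%:P.
  rewrite (mmap_homog _ _ _ (pihomogP _ e F)); congr (_ * _).
  apply: (@eq_mpoly_morphism A 3 {poly A} (mmap polyC _) (polyC \o meval f)) => [a|i] /=.
    by rewrite mmapC mevalC.
  by rewrite mmapX mmap1U mevalXU.
pose N := maxn (msize F) d.+1.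
have FE := pihomog_partitionE (leq_maxl (msize F) d.+1).
rewrite {1}FE rmorph_sum coef_sum (bigD1 (Ordinal (leq_maxr (msize F) d.+1))) //=.
rewrite hom coefMC coefXn eqxx mul1r big1 ?addr0 // => e ne.
rewrite hom coefMC coefXn; case: eqP => [de|]; last by rewrite mul0r.
by case/eqP: ne; apply: val_inj.
Qed.

Lemma linear_type_of_relations :
  (forall d F, F \is d.-homog -> F.@[f] = 0 -> linear_relation f F) ->
  of_linear_type f.
Proof.
move=> rel s t e; apply/eqP; rewrite -subr_eq0; apply/eqP.
have [F FE] := sym_presentation_surj (s - t).
have F0 : sym_to_poly (sym_presentation F) = 0.
  by rewrite -FE /sym_to_poly raddfB; apply/eqP; rewrite subr_eq0; apply/eqP.
have F1 := pihomog_partitionE (leqnn (msize F)).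
transitivity (\sum_(d < msize F) sym_presentation (pihomog mdeg d F)).
  by rewrite FE {1}F1; apply: (rmorph_sum sym_presentation).
apply: big1 => d _; apply/sym_presentation_relation/(rel d); first exact: pihomogP.
by rewrite -sym_to_poly_coef F0 coef0.
Qed.
End SymPresentation.

Definition syzygy_entry (A : comNzRingType) (f : 'I_3 -> A) (s : A) :=
  exists2 a : 'I_3 -> A, \sum_l a l * f l = 0 & exists i, a i = s.

Definition syzygy_ideal (A : comNzRingType) (f : 'I_3 -> A) (s : A) : Prop :=
  s \in ideal_span (syzygy_entry f).

Definition radical (A : comNzRingType) (P : A -> Prop) (s : A) :=
  exists n, P (s ^+ n).

Lemma radicalD (A : comNzRingType) (P : A -> Prop) s t :
  (forall a b, P a -> P b -> P (a + b)) -> (forall a b, P b -> P (a * b)) ->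
  radical P s -> radical P t -> radical P (s + t).
Proof.
move=> PD PM [m Ps] [n Pt]; exists (m + n); rewrite exprDn.
have P0 : P 0 by rewrite -(mul0r (s ^+ m)); apply: PM.
apply: (big_ind P) => // i _.
rewrite -mulr_natl; apply: (PM); have [le|lt] := leqP n i.
  by rewrite -(subnK le) exprD mulrA; apply: PM.
have le : (m <= m + n - i)%N by lia.
by rewrite mulrC -(subnK le) exprD mulrA; apply: PM.
Qed.

Section Criterion.
Variables (A : idomainType) (f : 'I_3 -> A) (x y z : A).
Hypothesis factA : factorial_ring A.
Hypothesis x0 : x != 0.
Hypothesis xy_reg : forall s t : A, x * s = y * t -> divides x t.
Hypothesis xyz_reg : forall r s t : A, z * r = x * s + y * t ->
  exists s' t', r = x * s' + y * t'.

Lemma lift_xy_reg (s t : {mpoly A[3]}) : x%:MP * s = y%:MP * t -> divides x%:MP t.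
Proof.
move=> e; have /choice[r rE] m : exists r, t@_m = x * r.
  by apply: (xy_reg (s := s@_m)); rewrite -!mcoeffCM e.
exists (\sum_(m <- msupp t) r m *: 'X_[m]).
rewrite {1}(mpolyE t) mulr_sumr; apply: eq_bigr => m _.
by rewrite rE mul_mpolyC scalerA.
Qed.

Lemma lift_xyz_reg (r s t : {mpoly A[3]}) :
  z%:MP * r = x%:MP * s + y%:MP * t ->
  exists s' t', r = x%:MP * s' + y%:MP * t'.
Proof.
move=> e; have /choice[st stE] m : exists st : A * A, r@_m = x * st.1 + y * st.2.
  have [|s' [t' ->]] := @xyz_reg (r@_m) (s@_m) (t@_m); last by exists (s', t').
  by rewrite -!mcoeffCM e mcoeffD.
exists (\sum_(m <- msupp r) (st m).1 *: 'X_[m]), (\sum_(m <- msupp r) (st m).2 *: 'X_[m]).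
rewrite {1}(mpolyE r) !mulr_sumr -big_split; apply: eq_bigr => m _ /=.
by rewrite stE !mul_mpolyC !scalerA -scalerDl.
Qed.

Hypotheses (xr : radical (syzygy_ideal f) x)
           (yr : radical (syzygy_ideal f) y)
           (zr : radical (syzygy_ideal f) z).

(** Dividing f by a common factor changes neither its syzygies nor the forms that
    vanish at it; so f may be assumed primitive. The elements with a power in the
    conductor of F into the linear relations form a radical ideal, which contains
    the entries of the syzygies, hence x, y and z. *)
Lemma linear_type_criterion : (exists k, f k != 0) -> of_linear_type f.
Proof.
move=> fn0; have [e [g [e0 fE gprim]]] := primitive_family_factor factA fn0.
have gn0 : exists k, g k != 0.
  by have [k fk0] := fn0; exists k; apply: contraNneq fk0 => gk0; rewrite fE gk0 mulr0.
have rel_fg F : linear_relation g F -> linear_relation f F.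
  move=> [al alg ->]; exists al => //; under eq_bigr do rewrite fE mpolyCM mulrCA.
  by rewrite -mulr_sumr alg mulr0.
apply: linear_type_of_relations => d F Fd Ff; apply: rel_fg.
have Fg : F.@[g] = 0.
  apply: (mulfI (expf_neq0 d e0)); rewrite mulr0 -Ff.
  rewrite /meval -(mmap_homog _ _ _ Fd); congr (mmap _ _ _).
  by apply: funext => l; rewrite fE.
pose ann s := linear_relation g (s%:MP * F).
have annD s t : ann s -> ann t -> ann (s + t).
  by rewrite /ann mpolyCD mulrDl; apply: linear_relationD.
have annM s t : ann t -> ann (s * t).
  by rewrite /ann mpolyCM -mulrA; apply: linear_relationM.
have rad_ann s : radical (syzygy_ideal f) s -> radical ann s.
  move=> [n /asboolP[r rP sE]].
  suff [M] : radical ann (s ^+ n) by rewrite -exprM; exists (n * M)%N.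
  rewrite sE big_seq; apply: (big_ind (radical ann)).
  - by exists 1%N; rewrite /ann mpolyC0 mul0r; apply: linear_relation0.
  - by move=> u v; apply: radicalD.
  move=> [b u] /rP /= [a af [i <-]]; exists d; rewrite exprMn; apply: annM.
  apply: syzygy_entry_power => //; move/eqP: af.
  under eq_bigr do rewrite fE mulrCA.
  by rewrite -mulr_sumr mulf_eq0 (negPf e0) => /eqP.
have [m xF] := rad_ann _ xr; have [n yF] := rad_ann _ yr; have [p zF] := rad_ann _ zr.
by apply: (linear_relation_saturated factA x0 lift_xy_reg lift_xyz_reg gn0 gprim xF yF zF).
Qed.
End Criterion.

(** * Homogeneous parts *)

Section Homogeneous.
Variables (R : comNzRingType) (n : nat).
Implicit Types F G : {mpoly R[n]}.
Local Notation pihomog := (pihomog mdeg).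

Lemma dhomog_var_exp i e : ('X_i ^+ e : {mpoly R[n]}) \is e.-homog.
Proof. by rewrite mpolyXn dhomogX /= mdegMn mdeg1 mul1n. Qed.

(** The case distinction is needed as d - e is truncated. *)
Lemma pihomogM_case d e F G : G \is e.-homog ->
  pihomog d (F * G) = if (e <= d)%N then pihomog (d - e) F * G else 0.
Proof.
move=> Ge; rewrite (mpolyE F) mulr_suml !raddf_sum /=.
rewrite (_ : (if _ then _ else _) =
  \sum_(m <- msupp F) if (e <= d)%N then pihomog (d - e) (F@_m *: 'X_[m]) * G else 0).
  apply: eq_bigr => m _; rewrite -scalerAl !linearZ /= pihomogX.
  have XG : 'X_[m] * G \is (mdeg m + e).-homog.
    by apply: dhomogM => //; rewrite dhomogX.
  have [<-|ne] := eqVneq (mdeg m + e)%N d.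
    by rewrite leq_addl addnK eqxx (pihomog_dE XG) scalerAl.
  rewrite (pihomog_ne0 ne XG) scaler0; case: leqP => // le.
  case: eqP => [me|_]; first by rewrite me subnK ?eqxx in ne.
  by rewrite scaler0 mul0r.
by case: leqP => _; rewrite ?mulr_suml // big1.
Qed.

Lemma pihomogC d (c : R) : pihomog d c%:MP_[n] = if d == 0%N then c%:MP_[n] else 0.
Proof.
rewrite -[c%:MP_[n]]mulr1 mul_mpolyC linearZ /= -mpolyX0 pihomogX /= mdeg0 eq_sym.
by case: eqP => // _; rewrite scaler0.
Qed.

Lemma dhomog_mderiv d i F : F \is d.+1.-homog -> F^`M(i) \is d.-homog.
Proof.
move=> /dhomogP Fd; apply/dhomogP => m; rewrite mcoeff_msupp mcoeff_deriv => nz.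
have : (m + U_(i))%MM \in msupp F.
  by rewrite mcoeff_msupp; apply: contraNneq nz => ->; rewrite mul0rn.
by move=> /Fd /=; rewrite mdegD mdeg1 addn1 => -[].
Qed.

Lemma euler_identity d F : F \is d.-homog -> \sum_i 'X_i * F^`M(i) = F *+ d.
Proof.
move=> /dhomogP Fd; rewrite {2}(mpolyE F) -sumrMnl.
under eq_bigr => i _ do rewrite {1}(mpolyE F) raddf_sum mulr_sumr.
rewrite exchange_big; rewrite big_seq [RHS]big_seq; apply: eq_bigr => m /Fd /= md.
under eq_bigr => i _ do rewrite /= linearZ /= mderivX -scalerAr -scalerAr -mpolyXD.
rewrite -scaler_sumr scalerMnr -md; congr (_ *: _).
rewrite mdegE -sumrMnr; apply: eq_bigr => i _.
case E : (m i) => [|a]; first by rewrite scale0r mulr0n.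
rewrite addmC submK ?scaler_nat //.
by rewrite lep1mP E.
Qed.
End Homogeneous.

Section HomogeneousParts.
Variables (R : comNzRingType) (n : nat) (B : comNzRingType).
Variables (phi : {rmorphism {poly B} -> {mpoly R[n]}}) (i : 'I_n).
Hypothesis phiX : phi 'X = 'X_i.

Lemma pihomog_poly_morphism d (p : {poly B}) :
  pihomog mdeg d (phi p) =
  \sum_(a < d.+1) pihomog mdeg (d - a) (phi (p`_a)%:P) * 'X_i ^+ a.
Proof.
pose N := maxn (size p) d.+1.
have pE : p = \sum_(a < N) (p`_a)%:P * 'X^a.
  rewrite -{1}[p]coefK poly_def (big_ord_widen N (fun a => p`_a *: 'X^a)) ?leq_maxl //.
  rewrite big_mkcond; apply: eq_bigr => a _; rewrite mul_polyC.
  by case: ltnP => // le; rewrite nth_default // scale0r.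
rewrite {1}pE !raddf_sum /=.
rewrite (big_ord_widen N (fun a => pihomog mdeg (d - a) (phi (p`_a)%:P) * 'X_i ^+ a))
  ?leq_maxr //.
rewrite [RHS]big_mkcond; apply: eq_bigr => a _.
by rewrite rmorphM rmorphXn /= phiX (pihomogM_case _ _ (dhomog_var_exp _ _ _)).
Qed.
End HomogeneousParts.

Lemma pihomog_nested (R : comNzRingType) (i j k : 'I_3) d (p : {poly {poly {poly R}}}) :
  pihomog mdeg d (of_nested i j k p) =
  \sum_(a < d.+1) \sum_(b < (d - a).+1)
     (p`_a`_b`_(d - a - b))%:MP * 'X_k ^+ (d - a - b) * 'X_j ^+ b * 'X_i ^+ a.
Proof.
rewrite [LHS](@pihomog_poly_morphism R 3 {poly {poly R}} (of_nested i j k) i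
  (of_nested_i R i j k)).
apply: eq_bigr => a _.
rewrite (pihomog_poly_morphism (phi := of_nested i j k \o polyC) (of_nested_j R i j k)).
rewrite mulr_suml; apply: eq_bigr => b _; congr (_ * _ * _) => /=.
rewrite (pihomog_poly_morphism (phi := of_nested i j k \o polyC \o polyC)
  (of_nested_k R i j k)).
rewrite big_ord_recr big1 ?add0r /= => [|c _].
  by rewrite add0r subnn of_nestedC pihomogC.
by rewrite of_nestedC pihomogC subn_eq0 leqNgt ltn_ord mul0r.
Qed.

(** * Elimination of a variable *)

Section Separable.
Variable R : idomainType.
Hypotheses (factR : factorial_ring R) (charR : forall n, n.+1%:R != 0 :> R).
Implicit Types a p : {poly R}.

Lemma prime_factor_size_gt1 a : (1 < size a)%N ->
  exists p, [/\ prime_element p, (1 < size p)%N & divides p a].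
Proof.
move=> sa; have a0 : a != 0 by rewrite -size_poly_gt0 ltnW.
have [u [s [uu sP aE]]] := factorial_poly factR a0.
have su : size u = 1%N by move: uu; rewrite poly_unitE => /andP[/eqP].
move: sa; rewrite aE {a a0 aE}; elim: s sP => [|p s IHs] sP.
  by rewrite big_nil mulr1 su.
have pp := sP p (mem_head _ _); have [sp _|sp] := ltnP 1 (size p).
  by exists p; split=> //; rewrite big_cons mulrCA; apply: dividesMl.
rewrite big_cons mulrCA [p]size1_polyC // => sz.
have [||q [pq sq dq]] := IHs.
- by move=> q qs; apply: sP; rewrite inE qs orbT.
- by apply: leq_trans sz _; rewrite mul_polyC size_scale_leq.
by exists q; split=> //; apply: divides_mull.
Qed.

Lemma deriv_eq0 a : a^`() = 0 -> (size a <= 1)%N.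
Proof.
move=> a'0; rewrite leqNgt; apply/negP => sa.
have := congr1 (fun q : {poly R} => q`_(size a).-2) a'0.
rewrite coef_deriv coef0 /=; have -> : (size a).-2.+1 = (size a).-1 by lia.
move/eqP; rewrite -mulr_natr mulf_eq0 => /orP[|].
  by rewrite -lead_coefE lead_coef_eq0 -size_poly_eq0; case: (size a) sa.
have -> : (size a).-1 = (size a).-2.+1 by lia.
by apply/negP/charR.
Qed.

(** If a and its derivative had a common factor over the fraction field, they
    would have a common prime divisor p of positive degree. From a = p b, p
    divides p' b; it does not divide p', whose degree is smaller and which is
    nonzero in characteristic 0; so p divides b and p ^ 2 divides a. *)
Lemma squarefree_separable a : a != 0 ->
  (forall p b, prime_element p -> a = p ^+ 2 * b -> False) ->
  exists c u v, c != 0 /\ c%:P = u * a + v * a^`().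
Proof.
move=> a0 sqf; have cop : coprimep a a^`().
  apply/negPn/negP => ncop.
  have g0 : gcdp a a^`() != 0 by rewrite gcdp_eq0 negb_and a0.
  have sg : (1 < size (gcdp a a^`()))%N.
    by rewrite ltn_neqAle eq_sym -coprimep_def ncop size_poly_gt0.
  have [p [pp sp [t gE]]] := prime_factor_size_gt1 sg.
  have [p0 pNu pP] := pp.
  have dvd b : gcdp a a^`() %| b -> divides p b.
    move=> /Pdiv.Idomain.dvdpP[[c q] /= c0 e].
    have [|[w cE]|//] := pP c%:P b.
      by rewrite mul_polyC e gE mulrCA; apply: dividesMl.
    have w0 : w != 0 by apply: contraNneq c0 => w0; rewrite -polyC_eq0 cE w0 mulr0.
    have := congr1 (fun q : {poly R} => size q) cE.
    by rewrite size_mul // size_polyC c0; rewrite -size_poly_gt0 in w0; lia.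
  have [b aE] := dvd _ (dvdp_gcdl _ _).
  have [b' a'E] := dvd _ (dvdp_gcdr _ _).
  have : divides p (p^`() * b).
    by exists (b' - b^`()); rewrite mulrBr -a'E aE derivM; ring.
  case/pP => [[w p'E]|[w bE]]; last first.
    by apply: (sqf p w pp); rewrite aE bE mulrA.
  have [p'0|p'0] := eqVneq p^`() 0; first by have := deriv_eq0 p'0; rewrite leqNgt sp.
  have w0 : w != 0 by apply: contraNneq p'0 => w0; rewrite p'E w0 mulr0.
  have := lt_size_deriv p0; rewrite p'E size_mul //.
  by rewrite -size_poly_gt0 in w0; lia.
have /Bezout_coprimepP[[u v] /=] := cop; rewrite -size_poly_eq1 => /eqP s1.
have e := size1_polyC (eq_leq s1); exists (u * a + v * a^`())`_0, u, v; split=> //.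
by rewrite -polyC_eq0 -e -size_poly_eq0 s1.
Qed.
End Separable.

(** The homogenization of r in degree n, in the variables X_i (of which 1 is the
    value in the affine chart) and X_j. *)
Definition binary_form (k : fieldType) (i j : 'I_3) n (r : {poly k}) : {mpoly k[3]} :=
  \sum_(b < n.+1) (r`_b)%:MP * 'X_i ^+ (n - b) * 'X_j ^+ b.

Lemma of_nested_unit (R : idomainType) (i j l : 'I_3) (p : {poly {poly {poly R}}}) :
  uniq [:: i; j; l] -> of_nested i j l p \is a GRing.unit -> p \is a GRing.unit.
Proof.
move=> ijl; exact: (@unit_transport {poly {poly {poly R}}} {mpoly R[3]}
  (of_nested i j l) (to_nested i j) (of_nestedK ijl)).
Qed.

Section Eliminant.
Variable k : fieldType.
Hypothesis chark : forall n, n.+1%:R != 0 :> k.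

Lemma pihomog_ideal2 d e1 e2 (f g u v : {mpoly k[3]})
  : f \is e1.-homog -> g \is e2.-homog ->
  exists u' v', pihomog mdeg d (u * f + v * g) = u' * f + v' * g.
Proof.
move=> fh gh; exists (if (e1 <= d)%N then pihomog mdeg (d - e1) u else 0).
exists (if (e2 <= d)%N then pihomog mdeg (d - e2) v else 0).
rewrite raddfD /= (pihomogM_case _ _ fh) (pihomogM_case _ _ gh).
by congr (_ + _); case: ifP => // _; rewrite mul0r.
Qed.

(** A Bezout relation between f and its derivative with respect to X_i, of which a
    nonzero homogeneous part is taken. *)
Lemma eliminant (f : {mpoly k[3]}) d (i j l : 'I_3) : uniq [:: i; j; l] ->
  f \is d.+1.-homog -> reduced_mpoly f ->
  exists n (r : {poly k}) u v, [/\ r != 0, (size r <= n.+1)%N &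
     binary_form l j n r = u * f + v * f^`M(i)].
Proof.
move=> ijl fh fred; pose a := to_nested i j f.
have fN0 : f != 0.
  apply/eqP => f0; have := fred 0 0; rewrite f0 mulr0 unitr0 => /(_ erefl).
  by [].
have a0 : a != 0 by apply: contraNneq fN0 => a0; rewrite -(to_nestedK ijl f) -/a a0 rmorph0.
have fact2 : factorial_ring {poly {poly k}} by do 2 apply: factorial_poly;
  apply: factorial_field.
have char2 n : n.+1%:R != 0 :> {poly {poly k}} by rewrite -!polyC_natr !polyC_eq0 chark.
have [p b [_ pNu _] aE|c [u [v [c0 cE]]]] := squarefree_separable fact2 char2 a0.
  have fE : f = of_nested i j l p ^+ 2 * of_nested i j l b.
    by rewrite -(to_nestedK ijl f) -/a aE (rmorphM (of_nested i j l))
      (rmorphXn (of_nested i j l)).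
  have pu := fred _ _ fE.
  by case/negP: pNu; apply: of_nested_unit ijl pu.
(* A nonzero coefficient of c, whose total degree b + e is the one to take. *)
have [b cb0] : exists b, c`_b != 0.
  by exists (size c).-1; rewrite -lead_coefE lead_coef_eq0.
have [e cbe0] : exists e, c`_b`_e != 0.
  by exists (size c`_b).-1; rewrite -lead_coefE lead_coef_eq0.
have rE : of_nested i j l c%:P = of_nested i j l u * f + of_nested i j l v * f^`M(i).
  rewrite cE rmorphD !rmorphM /= -(to_nested_deriv ijl) !(to_nestedK ijl) //.
have [u' [v' uvE]] := pihomog_ideal2 (b + e) (of_nested i j l u) (of_nested i j l v) fh
  (dhomog_mderiv i fh).
exists (b + e)%N, (\poly_(m < (b + e).+1) c`_m`_(b + e - m)), u', v'; split.
- apply: contraNneq cbe0 => /(congr1 (fun q : {poly k} => q`_b)).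
  by rewrite coef_poly coef0 ltnS leq_addr addKn => ->.
- exact: size_poly.
rewrite -uvE -rE pihomog_nested /binary_form [RHS]big_ord_recl /=
  [X in _ = _ + X]big1 ?addr0 => [|m _].
  rewrite !subn0; apply: eq_bigr => m _; rewrite coef_poly ltn_ord.
  by rewrite coefC eqxx expr0 mulr1.
apply: big1 => m' _; rewrite coefC /= !coef0 mpolyC0 !mul0r //.
Qed.
End Eliminant.

(** * A Nullstellensatz in the projective plane *)

Section IdealPredicates.
Variable A : comNzRingType.
Implicit Types I : A -> Prop.

Definition is_ideal I : Prop :=
  [/\ I 0, forall a b, I a -> I b -> I (a + b) & forall a b, I b -> I (a * b)].

Definition adjoin I (u : A) (t : A) : Prop := exists s b, I s /\ t = s + u * b.

Lemma adjoin_ideal I u : is_ideal I -> is_ideal (adjoin I u).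
Proof.
move=> [I0 ID IM]; split.
- by exists 0, 0; rewrite mulr0 addr0.
- move=> _ _ [s [b [Is ->]]] [t [c [It ->]]]; exists (s + t), (b + c).
  by split; [apply: ID | ring].
- move=> c _ [s [b [Is ->]]]; exists (c * s), (c * b).
  by split; [apply: IM | ring].
Qed.

Lemma sub_adjoin I u t : I t -> adjoin I u t.
Proof. by move=> It; exists t, 0; rewrite mulr0 addr0. Qed.

Lemma mem_adjoin I u : is_ideal I -> adjoin I u u.
Proof. by case=> I0 _ _; exists 0, 1; rewrite mulr1 add0r. Qed.

Lemma adjoinS I J u t : (forall s, I s -> J s) -> adjoin I u t -> adjoin J u t.
Proof. by move=> IJ [s [b [/IJ Js ->]]]; exists s, b. Qed.

Lemma radicalS I J t : (forall s, I s -> J s) -> radical I t -> radical J t.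
Proof. by move=> IJ [n /IJ]; exists n. Qed.

(** Geometrically, a zero of I where x is nonzero is a zero of u or of v. *)
Lemma radical_adjoinM I u v x : is_ideal I -> I (u * v) ->
  radical (adjoin I u) x -> radical (adjoin I v) x -> radical I x.
Proof.
move=> [I0 ID IM] Iuv [m [s [b [Is xm]]]] [n [t [c [It xn]]]].
exists (m + n); rewrite exprD xm xn.
have -> : (s + u * b) * (t + v * c) = (t + v * c) * s + (u * b) * t + (b * c) * (u * v).
  by ring.
by apply: (ID); [apply: (ID)|]; apply: (IM).
Qed.
End IdealPredicates.

Section ProjectiveNullstellensatz.
Variable k : closedFieldType.
Local Notation A := {mpoly k[3]}.
Implicit Type I : A -> Prop.

Lemma binary_form_mulX (i j : 'I_3) n (r : {poly k}) : (size r <= n.+1)%N ->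
  binary_form i j n.+1 r = 'X_i * binary_form i j n r.
Proof.
move=> sr; rewrite /binary_form big_ord_recr /= [r`_n.+1]nth_default //.
rewrite mpolyC0 !mul0r addr0 mulr_sumr; apply: eq_bigr => b _.
by rewrite subSn ?exprS -1?ltnS //; ring.
Qed.

Lemma binary_form_mul_linear (i j : 'I_3) n (r : {poly k}) a : (size r <= n.+1)%N ->
  binary_form i j n.+1 (('X - a%:P) * r) =
  ('X_j - a%:MP * 'X_i) * binary_form i j n r.
Proof.
move=> sr; rewrite [RHS]mulrBl -[_ * 'X_i * _]mulrA -(binary_form_mulX i j sr).
transitivity (binary_form i j n.+1 ('X * r) - a%:MP * binary_form i j n.+1 r).
  rewrite /binary_form mulr_sumr -sumrB; apply: eq_bigr => b _.
  by rewrite mulrBl coefB coefCM mpolyCB mpolyCM; ring.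
congr (_ - _); rewrite /binary_form big_ord_recl /= coefXM mpolyC0 !mul0r add0r.
rewrite mulr_sumr; apply: eq_bigr => b _; rewrite coefXM /= subSS exprS; ring.
Qed.

(** The form r is a product of lines X_j - a X_i and possibly of powers of X_i; so
    it suffices to treat the lines one at a time. *)
Lemma radical_binary_form I (i j : 'I_3) n (r : {poly k}) : is_ideal I ->
  r != 0 -> (size r <= n.+1)%N -> I (binary_form i j n r) ->
  (forall a, radical (adjoin I ('X_j - a%:MP * 'X_i)) 'X_i) -> radical I 'X_i.
Proof.
elim: n r I => [|n IHn] r I Iid r0 sr Ir Irad.
  exists 0%N; rewrite expr0; move: Ir; rewrite /binary_form big_ord_recl big_ord0 addr0 /=.
  rewrite !expr0 !mulr1; have [_ _ IM] := Iid => /(IM (r`_0)^-1%:MP).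
  rewrite -mpolyCM mulVf ?mpolyC1 //.
  by apply: contraNneq r0 => e; rewrite (size1_polyC sr) e.
have mono u a : radical (adjoin (adjoin I u) ('X_j - a%:MP * 'X_i)) 'X_i.
  by apply: radicalS (Irad a) => s; apply: adjoinS => t; apply: sub_adjoin.
have [sr'|sr'] := leqP (size r) n.+1.
  rewrite binary_form_mulX // in Ir; apply: (radical_adjoinM Iid Ir).
    by exists 1%N; rewrite expr1; apply: mem_adjoin.
  apply: (IHn r) => //; first exact: adjoin_ideal.
  exact: mem_adjoin.
have [a /factor_theorem[q rE]] : exists a, root r a.
  by apply/closed_rootP; rewrite gtn_eqF // (leq_ltn_trans _ sr').
have q0 : q != 0 by apply: contraNneq r0 => q0; rewrite rE q0 mul0r.
have sq : (size q <= n.+1)%N.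
  by move: sr; rewrite rE size_mul ?polyXsubC_eq0 // size_XsubC addn2.
rewrite rE mulrC binary_form_mul_linear // in Ir.
apply: (radical_adjoinM Iid Ir) => //.
apply: (IHn q) => //; first exact: adjoin_ideal.
exact: mem_adjoin.
Qed.

(** With two binary forms in I the claim reduces to a single point
    (X_i : X_j : X_l) = (1 : a : b) of the chart, and modulo the equations of this
    point a form of degree d is its value there times X_i ^ d. *)
Lemma projective_nullstellensatz I (i j l : 'I_3) n m (r s : {poly k}) :
  uniq [:: i; j; l] -> is_ideal I ->
  r != 0 -> (size r <= n.+1)%N -> I (binary_form i j n r) ->
  s != 0 -> (size s <= m.+1)%N -> I (binary_form i l m s) ->
  (forall p : 'I_3 -> k, p i != 0 ->
     exists d g, [/\ g \is d.-homog, I g & g.@[p] != 0]) ->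
  radical I 'X_i.
Proof.
move=> ijl Iid r0 sr Ir s0 ss Is pts.
apply: (radical_binary_form Iid r0 sr Ir) => a.
have I1 := adjoin_ideal ('X_j - a%:MP * 'X_i) Iid.
apply: (radical_binary_form I1 s0 ss (sub_adjoin _ Is)) => b.
have [I2 I2D I2M] := adjoin_ideal ('X_l - b%:MP * 'X_i) I1.
pose p t := if t == i then 1 else if t == j then a else b.
have [|d [g [gd Ig gp]]] := pts p; first by rewrite /p eqxx oner_eq0.
exists d; set K := adjoin _ _ in I2 I2D I2M *.
have Kg : K g by do 2 apply: sub_adjoin.
have cong : K (mmap (@mpolyC 3 k) (fun t => 'X_t) g -
    mmap (@mpolyC 3 k) (fun t => 'X_i * (p t)%:MP) g).
  apply: mmap_congr => // t; rewrite /p.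
  have [ji li lj] : [/\ j != i, l != i & l != j].
    by move: ijl; rewrite /= !inE negb_or ![_ == l]eq_sym [i == j]eq_sym => /and3P[/andP[]].
  case: (ord3_cases ijl t) => ->; rewrite ?eqxx ?(negPf ji) ?(negPf li) ?(negPf lj).
  - by rewrite mpolyC1 mulr1 subrr.
  - by apply: sub_adjoin; rewrite [_ * a%:MP]mulrC; apply: mem_adjoin.
  - by rewrite [_ * b%:MP]mulrC; apply: mem_adjoin.
rewrite subst_var (mmap_homog _ _ _ gd) (subst_meval p) in cong.
have -> : 'X_i ^+ d = (g.@[p])^-1%:MP * ('X_i ^+ d * (g.@[p])%:MP) :> A.
  by rewrite mulrCA -mpolyCM mulVf // mpolyC1 mulr1.
apply: (I2M); rewrite -[X in K X](subKr g); apply: I2D => //.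
by rewrite -mulN1r; apply: I2M.
Qed.
End ProjectiveNullstellensatz.

(** * From nonvanishing syzygies to linear type *)

Section VariableRegularity.
Variables (R : idomainType).
Local Notation A := {mpoly R[3]}.
Variables (i j l : 'I_3).
Hypothesis ijl : uniq [:: i; j; l].

Lemma mpolyX_neq0 (t : 'I_3) : 'X_t != 0 :> A.
Proof.
apply/eqP => /(congr1 (mcoeff U_(t)))/eqP.
by rewrite mcoeffX eqxx mcoeff0 oner_eq0.
Qed.

(** Setting X_i to 0 shows that t vanishes for X_i = 0. *)
Lemma variables_regular2 (s t : A) : 'X_i * s = 'X_j * t -> divides 'X_i t.
Proof.
have ji : j != i by move: ijl; rewrite /= !inE negb_or eq_sym => /andP[/andP[]].
pose P q : A := if q == i then 0 else 'X_q.
move=> /(congr1 (mmap (@mpolyC 3 R) P)).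
rewrite !rmorphM /= ![mmap _ _ 'X__]mmapX !mmap1U /P eqxx (negPf ji) mul0r.
move/esym/eqP; rewrite mulf_eq0 (negPf (mpolyX_neq0 j)) /= => /eqP t0.
rewrite -(subst_var t) -[X in divides _ X]subr0 -t0.
apply: mmap_congr => [|||q]; [exact: divides0|exact: dividesD|exact: divides_mull|].
case: eqP => [->|_]; last by rewrite subrr; apply: divides0.
by rewrite subr0; exists 1; rewrite mulr1.
Qed.

(** Setting X_i and X_j to 0 shows that r vanishes for X_i = X_j = 0. *)
Lemma variables_regular3 (r s t : A) : 'X_l * r = 'X_i * s + 'X_j * t ->
  exists s' t', r = 'X_i * s' + 'X_j * t'.
Proof.
have [li lj] : l != i /\ l != j.
  by move: ijl; rewrite /= !inE negb_or ![_ == l]eq_sym => /and3P[/andP[]].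
pose P q : A := if (q == i) || (q == j) then 0 else 'X_q.
move=> /(congr1 (mmap (@mpolyC 3 R) P)).
rewrite rmorphD !rmorphM /= ![mmap _ _ 'X__]mmapX !mmap1U /P !eqxx orbT.
rewrite (negPf li) (negPf lj) /= !mul0r addr0.
move/eqP; rewrite mulf_eq0 (negPf (mpolyX_neq0 l)) /= => /eqP r0.
have -> : r = mmap (@mpolyC 3 R) (fun q => 'X_q) r - mmap (@mpolyC 3 R) P r.
  by rewrite subst_var r0 subr0.
pose I (q : A) := exists s' t', q = 'X_i * s' + 'X_j * t'.
apply: (@mmap_congr _ _ _ _ I) => [|||q].
- by exists 0, 0; rewrite !mulr0 addr0.
- move=> _ _ [s1 [t1 ->]] [s2 [t2 ->]]; exists (s1 + s2), (t1 + t2); ring.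
- move=> u _ [s1 [t1 ->]]; exists (u * s1), (u * t1); ring.
have [->|qi] := eqVneq q i; first by exists 1, 0; rewrite /P eqxx /=; ring.
have [->|qj] := eqVneq q j; first by exists 0, 1; rewrite /P eqxx orbT; ring.
by exists 0, 0; rewrite /P (negPf qi) (negPf qj) subrr; ring.
Qed.
End VariableRegularity.

Section Gradient.
Variable k : closedFieldType.
Hypothesis chark : forall n, n.+1%:R != 0 :> k.
Local Notation A := {mpoly k[3]}.

(** At such a point two of the partial derivatives generate the localized gradient
    ideal. *)
Definition nonvanishing_syzygy (f : A) (p : 'I_3 -> k) : Prop :=
  exists a : 'I_3 -> A, \sum_l a l * f^`M(l) = 0 /\ exists l, (a l).@[p] != 0.

Lemma syzygy_ideal_is_ideal (f : 'I_3 -> A) : is_ideal (syzygy_ideal f).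
Proof.
have I0 := ideal_span0 (syzygy_entry f); have IP := @ideal_spanP _ (syzygy_entry f).
split=> // [a b ha hb|a b hb].
  by have := IP 1 _ _ ha hb; rewrite mul1r.
by have := IP a _ _ hb I0; rewrite addr0.
Qed.

(** It is an entry of the syzygy f_i T_j - f_j T_i. *)
Lemma koszul_entry (f : 'I_3 -> A) i : syzygy_ideal f (f i).
Proof.
apply: mem_ideal_span; have [j [l jli]] := ord3_complete i.
have [jl ji li] : [/\ j != l, j != i & l != i].
  by move: jli; rewrite /= !inE negb_or => /and3P[/andP[]].
exists (fun q => if q == j then f i else if q == i then - f j else 0).
  rewrite (sum_ord3 _ jli) eqxx [i == j]eq_sym (negPf ji) eqxx [l == j]eq_sym.
  by rewrite (negPf jl) (negPf li); ring.
by exists j; rewrite eqxx.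
Qed.

(** The homogeneous parts of a syzygy of forms of the same degree are again
    syzygies. *)
Lemma homogeneous_syzygy_entry (f : A) d p : f \is d.+1.-homog -> nonvanishing_syzygy f p ->
  exists e g, [/\ g \is e.-homog, syzygy_ideal (gradient f) g & g.@[p] != 0].
Proof.
move=> fh [a [af [l alp]]].
have [e alep] : exists e, (pihomog mdeg e (a l)).@[p] != 0.
  apply: contra_notP (elimN eqP alp) => h.
  rewrite {1}(pihomog_partitionE (leqnn (msize (a l)))) raddf_sum big1 // => e _.
  by apply/eqP/negPn/negP => ne; apply: h; exists e.
exists e, (pihomog mdeg e (a l)); split=> //; first exact: pihomogP.
apply: mem_ideal_span; exists (fun q => pihomog mdeg e (a q)); last by exists l.
have := congr1 (pihomog mdeg (e + d)) af; rewrite raddf_sum raddf0 /= => e0.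
rewrite -[RHS]e0.
apply: eq_bigr => q _; rewrite (pihomogM_case _ _ (dhomog_mderiv q fh)).
by rewrite leq_addl addnK.
Qed.

(** At a point outside V(J) some partial derivative is nonzero, and it is an entry
    of a Koszul syzygy; at a point of V(J) the hypothesis provides the entry that
    [projective_nullstellensatz] requires. *)
Theorem gradient_linear_type_of_local d (f : A) : f \is d.+1.-homog -> reduced_mpoly f ->
  (forall p : 'I_3 -> k, (exists i, p i != 0) -> (forall i, (f^`M(i)).@[p] = 0) ->
     nonvanishing_syzygy f p) ->
  gradient_linear_type f.
Proof.
move=> fh fred loc.
have Sid := syzygy_ideal_is_ideal (gradient f).
have fN0 : f != 0.
  by apply/eqP => f0; have := fred 0 0; rewrite f0 mulr0 unitr0 => /(_ erefl).
have gn0 : exists i, gradient f i != 0.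
  apply: contra_notP (elimN eqP fN0) => h; have := euler_identity fh.
  rewrite big1 => [/esym/eqP|i _]; last first.
    rewrite (_ : f^`M(i) = 0) ?mulr0 //.
    by apply/eqP/negPn/negP => ne; apply: h; exists i.
  rewrite -scaler_nat scaler_eq0 (negPf (chark d)) => /eqP //.
have pts p : (exists i, p i != 0) ->
    exists e g, [/\ g \is e.-homog, syzygy_ideal (gradient f) g & g.@[p] != 0].
  move=> pn0; have [/existsP[i gip]|/existsPn none] :=
    boolP [exists i, (f^`M(i)).@[p] != 0].
    exists d, f^`M(i); split=> //; first exact: dhomog_mderiv.
    exact: (koszul_entry (gradient f)).
  apply: homogeneous_syzygy_entry fh _; apply: loc => // i.
  by apply/eqP/negPn/none.
have elim i j l : uniq [:: i; j; l] -> exists n (r : {poly k}),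
  [/\ r != 0, (size r <= n.+1)%N &
    syzygy_ideal (gradient f) (binary_form l j n r)].
  move=> ijl; have [n [r [u [v [r0 sr rE]]]]] := eliminant chark ijl fh fred.
  exists n, r; split=> //; have [_ SD SM] := Sid; rewrite rE; apply: (SD); last first.
    by apply: (SM); apply: (koszul_entry (gradient f)).
  apply: (SM); suff : syzygy_ideal (gradient f) ((d.+1%:R^-1)%:MP * \sum_q 'X_q * f^`M(q)).
    by rewrite (euler_identity fh) -scaler_nat mul_mpolyC scalerA mulVf ?scale1r.
  apply: (SM); apply: big_ind; [by case: Sid | exact: SD | move=> q _].
  by apply: (SM); apply: (koszul_entry (gradient f)).
have rad i : radical (syzygy_ideal (gradient f)) 'X_i.
  have [j [l jli]] := ord3_complete i.
  have [ij il] : uniq [:: l; j; i] /\ uniq [:: j; l; i].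
    split=> //; move: jli; rewrite /= !inE !negb_or [j == l]eq_sym.
    by move=> /and3P[/andP[-> ->] -> _].
  have [n [r [r0 sr Ir]]] := elim _ _ _ ij.
  have [m [s [s0 ss Is]]] := elim _ _ _ il.
  apply: (projective_nullstellensatz (j := j) (l := l) _ Sid r0 sr Ir s0 ss Is).
    by move: jli; rewrite -(rot_uniq 2).
  by move=> p pi; apply: pts; exists i.
apply: (linear_type_criterion (x := 'X_0) (y := 'X_1) (z := 'X_2)) => //.
- by apply: factorial_mpoly3; apply: factorial_field.
- exact: mpolyX_neq0.
- exact: (variables_regular2 uniq_ord3).
- exact: (variables_regular3 uniq_ord3).
Qed.
End Gradient.

(** * Linear changes of coordinates *)

Section LinearChange.
Variable k : closedFieldType.
Local Notation A := {mpoly k[3]}.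
Implicit Types (f : A) (M N : 'M[k]_3) (v : 'I_3 -> k).

Definition linear_var M (l : 'I_3) : A := \sum_m (M m l)%:MP * 'X_m.
(** Points are row vectors: the value of [linear_change M f] at v is the value of
    f at v M. *)
Definition linear_change M : A -> A := mmap (@mpolyC 3 k) (linear_var M).
HB.instance Definition _ M := GRing.RMorphism.on (linear_change M).
Definition row_act M v (l : 'I_3) : k := \sum_m v m * M m l.

Lemma linear_changeC M c : linear_change M c%:MP = c%:MP.
Proof. exact: mmapC. Qed.
Lemma linear_changeX M l : linear_change M 'X_l = linear_var M l.
Proof. by rewrite /linear_change mmapX mmap1U. Qed.

Lemma linear_change_meval M f v : (linear_change M f).@[v] = f.@[row_act M v].
Proof.
apply: (@eq_mpoly_morphism k 3 k (meval v \o linear_change M) (meval (row_act M v)))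
  => [c|l] /=.
  by rewrite linear_changeC !mevalC.
rewrite linear_changeX mevalXU raddf_sum; apply: eq_bigr => m _.
by rewrite /= mevalM mevalC mevalXU mulrC.
Qed.

Lemma linear_changeM M N f : linear_change N (linear_change M f) = linear_change (N *m M) f.
Proof.
apply: (@eq_mpoly_morphism k 3 A (linear_change N \o linear_change M)
  (linear_change (N *m M))) => [c|l] /=.
  by rewrite !linear_changeC.
rewrite !linear_changeX rmorph_sum /=.
under eq_bigr do rewrite rmorphM /= linear_changeC linear_changeX mulr_sumr.
rewrite exchange_big; apply: eq_bigr => q _ /=.
rewrite mxE rmorph_sum mulr_suml; apply: eq_bigr => m _.
by rewrite /= mpolyCM; ring.
Qed.

Lemma linear_change1 f : linear_change 1%:M f = f.
Proof.
apply: (@eq_mpoly_morphism k 3 A (linear_change 1%:M) idfun) => [c|l] /=.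
  by rewrite linear_changeC.
rewrite linear_changeX /linear_var (bigD1 l) //= mxE eqxx mpolyC1 mul1r big1 ?addr0 //
  => m ml.
by rewrite mxE (negPf ml) mpolyC0 mul0r.
Qed.

Lemma linear_change_deriv M f i :
  (linear_change M f)^`M(i) = \sum_l (M i l)%:MP * linear_change M f^`M(l).
Proof.
elim/mpoly_ring_ind: f => [c|q|f g ef eg|f g ef eg].
- rewrite linear_changeC mderivC big1 // => l _.
  by rewrite mderivC rmorph0 mulr0.
- rewrite linear_changeX (bigD1 q) //= [X in _ = _ + X]big1 => [|l lq]; last first.
    by rewrite mderivX mnm1E eq_sym (negPf lq) scale0r rmorph0 mulr0.
  rewrite mderivX mnm1E eqxx scale1r -{1}[U_(q)%MM]add0m addmK mpolyX0 rmorph1 mulr1 addr0.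
  rewrite /linear_var raddf_sum (bigD1 i) //= big1 => [|m mi].
    by rewrite mderiv_mulC mderivX mnm1E eqxx scale1r -{1}[U_(i)%MM]add0m addmK mpolyX0
      mulr1 addr0.
  by rewrite mderiv_mulC mderivX mnm1E (negPf mi) scale0r mulr0.
- rewrite rmorphD mderivD ef eg -big_split; apply: eq_bigr => l _ /=.
  by rewrite mderivD rmorphD mulrDr.
- rewrite rmorphM /= mderivM ef eg mulr_suml mulr_sumr -big_split.
  apply: eq_bigr => l _ /=.
  by rewrite mderivM rmorphD !rmorphM /=; ring.
Qed.

Lemma linear_change_homog M d f : f \is d.-homog -> linear_change M f \is d.-homog.
Proof.
move=> /dhomogP fd; rewrite /linear_change /mmap big_seq; apply: rpred_sum => m /fd /= md.
rewrite mul_mpolyC; apply: dhomogZ; rewrite -md mdegE /mmap1.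
have lv l : linear_var M l \is 1.-homog.
  apply: rpred_sum => q _; rewrite mul_mpolyC; apply: dhomogZ.
  by rewrite dhomogX /= mdeg1.
apply: (big_ind2 (fun (F : A) e => F \is e.-homog)) => [|F e G e' Fe Ge|l _].
- exact: dhomog1.
- exact: dhomogM.
- by rewrite -[X in X.-homog]mul1n; apply: dhomogMn.
Qed.

Variable M : 'M[k]_3.
Hypothesis unitM : M \in unitmx.

Lemma linear_changeK f : linear_change (invmx M) (linear_change M f) = f.
Proof. by rewrite linear_changeM mulVmx // linear_change1. Qed.
Lemma linear_changeVK f : linear_change M (linear_change (invmx M) f) = f.
Proof. by rewrite linear_changeM mulmxV // linear_change1. Qed.

Lemma linear_change_reduced f : reduced_mpoly f -> reduced_mpoly (linear_change M f).
Proof.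
move=> fred g h e.
have fE : f = linear_change (invmx M) g ^+ 2 * linear_change (invmx M) h.
  by rewrite -[LHS]linear_changeK e rmorphM rmorphXn.
have := rmorph_unit (linear_change M) (fred _ _ fE).
by rewrite /= linear_changeVK.
Qed.

(** By the chain rule the product by M carries syzygies of one gradient to those
    of the other, and M is invertible at the point. *)
Lemma nonvanishing_syzygy_change f v :
  nonvanishing_syzygy (linear_change M f) v -> nonvanishing_syzygy f (row_act M v).
Proof.
move=> [a [af [i aiv]]].
pose b l := \sum_i linear_change (invmx M) (a i) * (M i l)%:MP.
exists b; split.
  have := congr1 (linear_change (invmx M)) af; rewrite rmorph0 rmorph_sum /= => {2}<-.
  under eq_bigr do rewrite mulr_suml.
  rewrite exchange_big; apply: eq_bigr => q _.
  rewrite linear_change_deriv rmorphM rmorph_sum mulr_sumr /=; apply: eq_bigr => l _.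
  by rewrite rmorphM /= linear_changeC linear_changeK mulrA.
have bE l : (b l).@[row_act M v] = (\row_i (a i).@[v] *m M) 0 l.
  rewrite mxE raddf_sum; apply: eq_bigr => q _.
  by rewrite /= mevalM mevalC mxE -linear_change_meval linear_changeVK.
apply: contra_notP (elimN eqP aiv) => h.
have : \row_i (a i).@[v] *m M = 0.
  apply/rowP => l; rewrite -bE mxE; apply/eqP/negPn/negP => ne; apply: h.
  by exists l.
move=> /(congr1 (mulmx^~ (invmx M))); rewrite mulmxK // mul0mx => /rowP/(_ i).
by rewrite !mxE.
Qed.
End LinearChange.

(** * Localization along the cone over a point *)

Section LocalAlgebra.
Variable k : closedFieldType.
Hypothesis chark : forall n, n.+1%:R != 0 :> k.
Local Notation A := {mpoly k[3]}.
Local Notation x := ('X_0 : A).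
Local Notation y := ('X_1 : A).
Local Notation z := ('X_2 : A).
Implicit Types (f e s : A).

Definition base_point (l : 'I_3) : k := (l == 2)%:R.

(** The restriction to the line x = y = 0, with X for the restriction of z. Its
    kernel is the prime ideal (x, y) of the cone over the base point (0 : 0 : 1). *)
Definition axis : A -> {poly k} := mmap polyC (fun l => 'X * (base_point l)%:P).
HB.instance Definition _ := GRing.RMorphism.on axis.

Lemma axisC c : axis c%:MP = c%:P.
Proof. exact: mmapC. Qed.
Lemma axisX0 : axis x = 0.
Proof. by rewrite /axis mmapX mmap1U mulr0. Qed.
Lemma axisX1 : axis y = 0.
Proof. by rewrite /axis mmapX mmap1U mulr0. Qed.
Lemma axisX2 : axis z = 'X.
Proof. by rewrite /axis mmapX mmap1U mulr1. Qed.

Lemma ord3_012 (l : 'I_3) : [\/ l = 0, l = 1 | l = 2].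
Proof. exact: (ord3_cases uniq_ord3). Qed.

Lemma axis_eq0 w : axis w = 0 -> exists w1 w2, w = w1 * x + w2 * y.
Proof.
move=> w0; pose P (l : 'I_3) := (if l == 2 then z else 0 : A).
have P0 : mmap (@mpolyC 3 k) P w = 0.
  transitivity (poly_eval (@mpolyC 3 k) z (axis w)); last by rewrite w0 rmorph0.
  apply: (@eq_mpoly_morphism k 3 A (mmap (@mpolyC 3 k) P)
    (poly_eval (@mpolyC 3 k) z \o axis)) => [c|l] /=.
    by rewrite mmapC axisC poly_evalC.
  rewrite mmapX mmap1U; case: (ord3_012 l) => ->; rewrite /P /=.
  - by rewrite axisX0 rmorph0.
  - by rewrite axisX1 rmorph0.
  - by rewrite axisX2 poly_evalX.
have -> : w = mmap (@mpolyC 3 k) (fun q => 'X_q) w - mmap (@mpolyC 3 k) P w.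
  by rewrite subst_var P0 subr0.
pose I (q : A) := exists w1 w2, q = w1 * x + w2 * y.
apply: (@mmap_congr _ _ _ _ I) => [|||q].
- by exists 0, 0; rewrite !mul0r addr0.
- move=> _ _ [s1 [t1 ->]] [s2 [t2 ->]]; exists (s1 + s2), (t1 + t2); ring.
- move=> u _ [s1 [t1 ->]]; exists (u * s1), (u * t1); ring.
case: (ord3_012 q) => ->; rewrite /P /=.
- by exists 1, 0; ring.
- by exists 0, 1; ring.
- by exists 0, 0; ring.
Qed.

Lemma axis_homog d f : f \is d.-homog -> axis f = 'X^d * (f.@[base_point])%:P.
Proof.
move=> fd; rewrite /axis (mmap_homog _ _ _ fd); congr (_ * _).
apply: (@eq_mpoly_morphism k 3 {poly k} (mmap polyC (fun l => (base_point l)%:P))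
  (polyC \o meval base_point)) => [c|l] /=.
  by rewrite mmapC mevalC.
by rewrite mmapX mmap1U mevalXU.
Qed.

Lemma axis_part s : axis s != 0 -> exists d, (pihomog mdeg d s).@[base_point] != 0.
Proof.
move=> s0; apply: contra_notP (elimN eqP s0) => h.
rewrite (pihomog_partitionE (leqnn (msize s))) rmorph_sum big1 // => d _ /=.
rewrite (axis_homog (pihomogP _ d s)).
have -> : (pihomog mdeg d s).@[base_point] = 0.
  by apply/eqP/negPn/negP => ne; apply: h; exists (d : nat).
by rewrite mulr0.
Qed.

(** Membership in the extension of I to the local ring of A at (x, y). *)
Definition localized (I : A -> Prop) e := exists s, axis s != 0 /\ I (s * e).

Lemma axisM_neq0 s e : axis s != 0 -> axis e != 0 -> axis (s * e) != 0.
Proof. by move=> s0 e0; rewrite rmorphM mulf_neq0. Qed.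

Section Localized.
Variable I : A -> Prop.
Hypothesis Iid : is_ideal I.

Lemma sub_localized e : I e -> localized I e.
Proof. by exists 1; rewrite rmorph1 oner_eq0 mul1r. Qed.

Lemma localized_ideal : is_ideal (localized I).
Proof.
have [I0 ID IM] := Iid; split.
- exact: sub_localized.
- move=> a b [s [s0 Ia]] [t [t0 Ib]]; exists (s * t); split; first exact: axisM_neq0.
  have -> : s * t * (a + b) = t * (s * a) + s * (t * b) by ring.
  by apply: ID; apply: IM.
- by move=> a b [s [s0 Ib]]; exists s; split=> //; rewrite mulrCA; apply: IM.
Qed.

Lemma localized_cancel s e : axis s != 0 -> localized I (s * e) -> localized I e.
Proof.
move=> s0 [t [t0 Ie]]; exists (t * s); split; first exact: axisM_neq0.
by rewrite -mulrA.
Qed.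

Let LD a b : localized I a -> localized I b -> localized I (a + b).
Proof. by case: localized_ideal => _ D _; apply: D. Qed.
Let LM a b : localized I b -> localized I (a * b).
Proof. by case: localized_ideal => _ _ M; apply: M. Qed.
Let LB a b : localized I a -> localized I b -> localized I (a - b).
Proof. by move=> La Lb; apply: LD => //; rewrite -mulN1r; apply: LM. Qed.

(** This and the next two lemmas are Nakayama's lemma by elimination: if the
    combinations of the e_i with coefficients b_ij are in the localized ideal and
    the matrix is lower triangular and invertible at (x, y), then so are the e_i.
    The last e_i is eliminated first. *)
Lemma nakayama2 e1 e2 b11 b12 b21 b22 :
  axis b11 != 0 -> axis b22 != 0 -> axis b12 = 0 ->
  localized I (b11 * e1 + b12 * e2) -> localized I (b21 * e1 + b22 * e2) ->
  localized I e1 /\ localized I e2.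
Proof.
move=> d1 d2 z12 L1 L2; have Le1 : localized I e1.
  apply: (@localized_cancel (b22 * b11 - b12 * b21)).
    by rewrite rmorphB !rmorphM /= z12 mul0r subr0 mulf_neq0.
  have -> : (b22 * b11 - b12 * b21) * e1 =
    b22 * (b11 * e1 + b12 * e2) - b12 * (b21 * e1 + b22 * e2) by ring.
  by apply: LB; apply: LM.
split=> //; apply: (localized_cancel d2).
have -> : b22 * e2 = (b21 * e1 + b22 * e2) - b21 * e1 by ring.
by apply: LB => //; apply: LM.
Qed.

Lemma nakayama3 e1 e2 e3 b11 b12 b13 b21 b22 b23 b31 b32 b33 :
  [/\ axis b11 != 0, axis b22 != 0 & axis b33 != 0] ->
  [/\ axis b12 = 0, axis b13 = 0 & axis b23 = 0] ->
  localized I (b11 * e1 + b12 * e2 + b13 * e3) ->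
  localized I (b21 * e1 + b22 * e2 + b23 * e3) ->
  localized I (b31 * e1 + b32 * e2 + b33 * e3) ->
  [/\ localized I e1, localized I e2 & localized I e3].
Proof.
move=> [d1 d2 d3] [z12 z13 z23] L1 L2 L3.
have [|||||Le1 Le2] := @nakayama2 e1 e2 (b33 * b11 - b13 * b31) (b33 * b12 - b13 * b32)
    (b33 * b21 - b23 * b31) (b33 * b22 - b23 * b32).
- by rewrite rmorphB !rmorphM /= z13 mul0r subr0 mulf_neq0.
- by rewrite rmorphB !rmorphM /= z23 mul0r subr0 mulf_neq0.
- by rewrite rmorphB !rmorphM /= z12 z13 mul0r mulr0 subr0.
- rewrite (_ : _ + _ = b33 * (b11 * e1 + b12 * e2 + b13 * e3) - b13 *
  (b31 * e1 + b32 * e2 + b33 * e3)); last by ring.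
  by apply: LB; apply: LM.
- rewrite (_ : _ + _ = b33 * (b21 * e1 + b22 * e2 + b23 * e3) - b23 *
  (b31 * e1 + b32 * e2 + b33 * e3)); last by ring.
  by apply: LB; apply: LM.
split=> //; apply: (localized_cancel d3).
have -> : b33 * e3 = (b31 * e1 + b32 * e2 + b33 * e3) - b31 * e1 - b32 * e2 by ring.
by apply: (LB); first apply: (LB) => //; apply: LM.
Qed.

Lemma nakayama4 e1 e2 e3 e4 b11 b12 b13 b14 b21 b22 b23 b24
    b31 b32 b33 b34 b41 b42 b43 b44 :
  [/\ axis b11 != 0, axis b22 != 0, axis b33 != 0 & axis b44 != 0] ->
  [/\ axis b12 = 0, axis b13 = 0 & axis b23 = 0] ->
  [/\ axis b14 = 0, axis b24 = 0 & axis b34 = 0] ->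
  localized I (b11 * e1 + b12 * e2 + b13 * e3 + b14 * e4) ->
  localized I (b21 * e1 + b22 * e2 + b23 * e3 + b24 * e4) ->
  localized I (b31 * e1 + b32 * e2 + b33 * e3 + b34 * e4) ->
  localized I (b41 * e1 + b42 * e2 + b43 * e3 + b44 * e4) ->
  [/\ localized I e1, localized I e2, localized I e3 & localized I e4].
Proof.
move=> [d1 d2 d3 d4] [z12 z13 z23] [z14 z24 z34] L1 L2 L3 L4.
pose c (bij bi4 b4j : A) := b44 * bij - bi4 * b4j.
have c0 bij bi4 b4j : axis bij = 0 -> axis bi4 = 0 -> axis (c bij bi4 b4j) = 0.
  by move=> h1 h2; rewrite rmorphB !rmorphM /= h1 h2 mul0r mulr0 subr0.
have cn0 bij bi4 b4j : axis bij != 0 -> axis bi4 = 0 -> axis (c bij bi4 b4j) != 0.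
  by move=> h1 h2; rewrite rmorphB !rmorphM /= h2 mul0r subr0 mulf_neq0.
have [|||||Le1 Le2 Le3] := @nakayama3 e1 e2 e3 (c b11 b14 b41) (c b12 b14 b42)
  (c b13 b14 b43)
   (c b21 b24 b41) (c b22 b24 b42) (c b23 b24 b43) (c b31 b34 b41) (c b32 b34 b42)
     (c b33 b34 b43).
- by split; apply: cn0.
- by split; apply: c0.
- rewrite (_ : _ + _ = b44 * (b11 * e1 + b12 * e2 + b13 * e3 + b14 * e4) -
    b14 * (b41 * e1 + b42 * e2 + b43 * e3 + b44 * e4)); last by rewrite /c; ring.
  by apply: LB; apply: LM.
- rewrite (_ : _ + _ = b44 * (b21 * e1 + b22 * e2 + b23 * e3 + b24 * e4) -
    b24 * (b41 * e1 + b42 * e2 + b43 * e3 + b44 * e4)); last by rewrite /c; ring.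
  by apply: LB; apply: LM.
- rewrite (_ : _ + _ = b44 * (b31 * e1 + b32 * e2 + b33 * e3 + b34 * e4) -
    b34 * (b41 * e1 + b42 * e2 + b43 * e3 + b44 * e4)); last by rewrite /c; ring.
  by apply: LB; apply: LM.
split=> //; apply: (localized_cancel d4).
have -> : b44 * e4 = (b41 * e1 + b42 * e2 + b43 * e3 + b44 * e4)
  - b41 * e1 - b42 * e2 - b43 * e3 by ring.
by do 3 (apply: (LB); last exact: LM).
Qed.
End Localized.

Definition partial_ideal f e := exists u v, e = u * f^`M(0) + v * f^`M(1).

Lemma partial_ideal_is_ideal f : is_ideal (partial_ideal f).
Proof.
split.
- by exists 0, 0; ring.
- move=> _ _ [s1 [t1 ->]] [s2 [t2 ->]]; exists (s1 + s2), (t1 + t2); ring.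
- move=> u _ [s1 [t1 ->]]; exists (u * s1), (u * t1); ring.
Qed.

(** A relation s f_z = u f_x + v f_y with s nonzero on the axis is a syzygy, one
    of whose homogeneous parts is nonzero at the base point. *)
Lemma localized_nonvanishing d f : f \is d.+1.-homog ->
  localized (partial_ideal f) f^`M(2) -> nonvanishing_syzygy f base_point.
Proof.
move=> fh [s [/axis_part[e se] [u [v suv]]]].
pose a (l : 'I_3) : A := if l == 0 then - u else if l == 1 then - v else s.
exists (fun l => pihomog mdeg e (a l)); split; last by exists 2.
have a0 : \sum_l a l * f^`M(l) = 0.
  by rewrite (sum_ord3 _ uniq_ord3) /a /= suv; ring.
have := congr1 (pihomog mdeg (e + d)) a0; rewrite raddf_sum raddf0 /= => e0.
rewrite -[RHS]e0; apply: eq_bigr => q _; rewrite (pihomogM_case _ _ (dhomog_mderiv q fh)).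
by rewrite leq_addl addnK.
Qed.

(** By the Euler identity, z being a unit at (x, y). *)
Lemma localized_of_mem d f : f \is d.-homog ->
  localized (partial_ideal f) f -> localized (partial_ideal f) f^`M(2).
Proof.
move=> fh Lf; apply: (@localized_cancel _ z); first by rewrite axisX2 polyX_eq0.
have [_ LD LM] := localized_ideal (partial_ideal_is_ideal f).
have := euler_identity fh; rewrite (sum_ord3 _ uniq_ord3) => e.
have -> : z * f^`M(2) = d%:R * f + ((- x) * f^`M(0) + (- y) * f^`M(1)).
  by rewrite mulr_natl -e; ring.
apply: LD; first exact: LM.
by apply: sub_localized; exists (- x), (- y).
Qed.
End LocalAlgebra.

(** * Double points *)

Lemma mderiv_var (R : comNzRingType) n (i j : 'I_n) :
  ('X_j : {mpoly R[n]})^`M(i) = (i == j)%:R.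
Proof.
rewrite mderivX mnm1E eq_sym; case: eqP => [->|_]; last by rewrite scale0r.
by rewrite scale1r -{1}[U_(j)%MM]add0m addmK mpolyX0.
Qed.

Lemma mderiv_exp (R : comNzRingType) n (i : 'I_n) (F : {mpoly R[n]}) m :
  (F ^+ m.+1)^`M(i) = m.+1%:R * F ^+ m * F^`M(i).
Proof.
elim: m => [|m IHm]; first by rewrite expr1 expr0 !mul1r.
by rewrite exprS mderivM IHm -[in RHS]natr1 exprS; ring.
Qed.

Section SmoothPolar.
Variable k : closedFieldType.
Hypothesis chark : forall n, n.+1%:R != 0 :> k.
Local Notation A := {mpoly k[3]}.
Local Notation x := ('X_0 : A).
Local Notation y := ('X_1 : A).
Local Notation z := ('X_2 : A).
Variable f : A.
Local Notation h := (f^`M(0)).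
Hypotheses (f0 : axis f = 0) (h0 : axis h = 0) (hx0 : axis h^`M(0) != 0).

Let L := localized (partial_ideal f).
Let Lid : is_ideal L := localized_ideal (partial_ideal_is_ideal f).

(** Differentiate along the polar curve h = 0, that is, apply
    D = h_x d/dy - h_y d/dx, which kills h and takes f to h_x f_y modulo h. From
    f = w y ^ (m + 1) on the curve with w a unit, one gets that y ^ m times a unit
    is in (h, f_y). *)
Lemma polar_branch_derivative s w t m : axis s != 0 -> axis w != 0 ->
  s * f = w * y ^+ m.+1 + h * t -> L f.
Proof.
move=> s0 w0 sf; have [_ LD LM] := Lid.
pose D (e : A) := h^`M(0) * e^`M(1) - h^`M(1) * e^`M(0).
(* The unit by which y ^ m is multiplied, up to terms in (h, f_y). *)
pose c := m.+1%:R * (s * w * h^`M(0)) + y * (s * D w - D s * w).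
have Lym : L (y ^+ m).
  apply: (@localized_cancel _ _ c).
    rewrite rmorphD !rmorphM /= axisX1 mul0r addr0 rmorph_nat !mulf_neq0 //.
    by rewrite -polyC_natr polyC_eq0 chark.
  apply: sub_localized.
  exists (- s ^+ 2 * h^`M(1) - s * D t + D s * t), (s ^+ 2 * h^`M(0)).
  have e0 := congr1 (mderiv 0) sf; have e1 := congr1 (mderiv 1) sf.
  rewrite !mderivD !mderivM mderiv_exp mderiv_var /= mulr0 mulr0 addr0 in e0.
  rewrite !mderivD !mderivM mderiv_exp mderiv_var /= mulr1 in e1.
  rewrite /c /D.
  move: e0 e1 sf; rewrite !exprS.
  set Y := y ^+ m; set N := m.+1%:R; move=> /eqP; rewrite -subr_eq0 => /eqP E0.
  move=> /eqP; rewrite -subr_eq0 => /eqP E1.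
  move=> /eqP; rewrite -subr_eq0 => /eqP E.
  transitivity ((- s ^+ 2 * h^`M(1) - s * D t + D s * t) * h + s ^+ 2 * h^`M(0) * f^`M(1)
    - (s * (h^`M(0) * 0 - h^`M(1) * 0) - D s * 0)); last by rewrite /D; ring.
  by rewrite -{1}E1 -{1}E0 -E /D; ring.
have Lsf : L (s * f).
  rewrite sf exprS; apply: (LD); first by rewrite mulrA; apply: LM.
  by apply: sub_localized; exists t, 0; ring.
exact: localized_cancel s0 Lsf.
Qed.

(** As h = u x + v y with u a unit, y is a uniformizer of the polar curve at the
    base point. So either the coefficient of y ^ n in the expansion of f is a unit
    and [polar_branch_derivative] applies, or f is divisible by y ^ (n + 1) on the
    curve. *)
Lemma polar_branch_expansion n : L f \/
  exists s w t, axis s != 0 /\ s * f = w * y ^+ n + h * t.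
Proof.
have [u [v hE]] := axis_eq0 h0.
have u0 : axis u != 0.
  move: hx0; rewrite {1}hE mderivD !mderivM !mderiv_var /= mulr1 mulr0 addr0.
  by rewrite !rmorphD !rmorphM /= axisX0 axisX1 !mulr0 add0r addr0.
elim: n => [|n [Lf|[s [w [t [s0 sf]]]]]]; [right | by left |].
  by exists 1, f, 0; rewrite rmorph1 oner_eq0; split=> //; ring.
have [w0|w0] := eqVneq (axis w) 0; last first.
  left; case: n sf => [|n] sf; last exact: polar_branch_derivative s0 w0 sf.
  case/eqP: w0; have := congr1 (@axis k) sf.
  by rewrite expr0 mulr1 rmorphD !rmorphM /= f0 h0 mulr0 mul0r addr0.
right; have [w1 [w2 wE]] := axis_eq0 w0.
exists (u * s), (u * w2 - w1 * v), (w1 * y ^+ n + u * t); split; first exact: axisM_neq0.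
rewrite -mulrA sf wE exprS.
transitivity (w1 * y ^+ n * (u * x + v * y) + (u * w2 - w1 * v) * (y * y ^+ n) + h *
  (u * t)); first by ring.
by rewrite -hE; ring.
Qed.

(** The relation r y ^ j = a f + b h bounds the order of vanishing of f on the
    polar curve: if f is divisible there by y ^ (j + 1), then y ^ j, and with it
    f, vanishes on the curve. *)
Lemma smooth_polar j r a b : axis r != 0 -> y ^+ j * r = a * f + b * h -> L f.
Proof.
move=> r0 rE; have [_ LD LM] := Lid.
have [//|[s [w [t [s0 sf]]]]] := polar_branch_expansion j.+1.
have Lyj : L (y ^+ j).
  apply: (@localized_cancel _ _ (s * r - a * w * y)).
    by rewrite rmorphB !rmorphM /= axisX1 mulr0 subr0 mulf_neq0.
  apply: sub_localized; exists (a * t + s * b), 0.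
  transitivity (s * (y ^+ j * r) - a * (w * y ^+ j.+1)); first by rewrite exprS; ring.
  have -> : w * y ^+ j.+1 = s * f - h * t by rewrite sf addrK.
  by rewrite rE; ring.
apply: (localized_cancel s0); rewrite -/L sf exprS; apply: (LD).
  by rewrite mulrA; apply: LM.
by apply: sub_localized; exists t, 0; ring.
Qed.
End SmoothPolar.

(** * Triple points *)

Section QuarticGerms.
Variable k : closedFieldType.
Hypothesis chark : forall n, n.+1%:R != 0 :> k.
Local Notation A := {mpoly k[3]}.
Local Notation x := ('X_0 : A).
Local Notation y := ('X_1 : A).
Local Notation z := ('X_2 : A).
Implicit Types (a c q : k).

Definition cubic_form c0 c1 c2 c3 : A :=
  c0%:MP * x ^+ 3 + c1%:MP * (x ^+ 2 * y) + c2%:MP * (x * y ^+ 2) + c3%:MP * y ^+ 3.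

(** The general quartic with a singular point at (0 : 0 : 1), in order of
    decreasing powers of z. *)
Definition quartic a0 a1 a2 c0 c1 c2 c3 q0 q1 q2 q3 q4 : A :=
  z ^+ 2 * (a0%:MP * x ^+ 2 + a1%:MP * x * y + a2%:MP * y ^+ 2) +
  z * cubic_form c0 c1 c2 c3 +
  (q0%:MP * x ^+ 4 + q1%:MP * x ^+ 3 * y + q2%:MP * x ^+ 2 * y ^+ 2 +
   q3%:MP * x * y ^+ 3 + q4%:MP * y ^+ 4).

Ltac deriv_simpl := rewrite /quartic /cubic_form;
  rewrite !(mderivD, mderivM, mderiv_exp, mderivC, mderiv_var) /=.

Lemma quartic_dx a0 a1 a2 c0 c1 c2 c3 q0 q1 q2 q3 q4 :
  (quartic a0 a1 a2 c0 c1 c2 c3 q0 q1 q2 q3 q4)^`M(0) =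
  z ^+ 2 * (2%:R * a0%:MP * x + a1%:MP * y) +
  z * (3%:R * c0%:MP * x ^+ 2 + 2%:R * c1%:MP * x * y + c2%:MP * y ^+ 2) +
  (4%:R * q0%:MP * x ^+ 3 + 3%:R * q1%:MP * x ^+ 2 * y +
   2%:R * q2%:MP * x * y ^+ 2 + q3%:MP * y ^+ 3).
Proof. by deriv_simpl; ring. Qed.

Lemma quartic_dy a0 a1 a2 c0 c1 c2 c3 q0 q1 q2 q3 q4 :
  (quartic a0 a1 a2 c0 c1 c2 c3 q0 q1 q2 q3 q4)^`M(1) =
  z ^+ 2 * (a1%:MP * x + 2%:R * a2%:MP * y) +
  z * (c1%:MP * x ^+ 2 + 2%:R * c2%:MP * x * y + 3%:R * c3%:MP * y ^+ 2) +
  (q1%:MP * x ^+ 3 + 2%:R * q2%:MP * x ^+ 2 * y +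
   3%:R * q3%:MP * x * y ^+ 2 + 4%:R * q4%:MP * y ^+ 3).
Proof. by deriv_simpl; ring. Qed.

Lemma quartic_dz c0 c1 c2 c3 q0 q1 q2 q3 q4 :
  (quartic 0 0 0 c0 c1 c2 c3 q0 q1 q2 q3 q4)^`M(2) = cubic_form c0 c1 c2 c3.
Proof. by deriv_simpl; rewrite !mpolyC0; ring. Qed.

Ltac axis_simpl := rewrite !(rmorphD, rmorphB, rmorphN, rmorphM, rmorphXn,
   rmorph_nat, rmorph0) /= ?axisC ?axisX0 ?axisX1 ?axisX2.
Ltac axis_zero := axis_simpl; ring.
(** The form in which the diagonal coefficients are given below; the power m of z
    may be 0. *)
Lemma axis_unit n c m w : c != 0 -> axis w = 0 ->
  axis (n.+1%:R * c%:MP * z ^+ m + w) != 0.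
Proof.
move=> c0 w0; rewrite rmorphD /= w0 addr0 !rmorphM rmorphXn rmorph_nat /= axisC axisX2.
by rewrite -polyC_natr !mulf_neq0 ?expf_neq0 ?polyC_eq0 ?polyX_eq0 ?chark.
Qed.

(** The tangent cone is x (c0 x^2 + c1 x y + c2 y^2), a product of three distinct
    lines. Modulo (x, y)^4, the products of f_x and f_y by x and y are four
    linearly independent cubic forms; so all cubic forms belong to the localized
    ideal. The combinations chosen make the system triangular. *)
Lemma triple_point_D4 c0 c1 c2 q0 q1 q2 q3 q4
    (f := quartic 0 0 0 c0 c1 c2 0 q0 q1 q2 q3 q4) :
  c0 != 0 -> c2 != 0 -> c1 ^+ 2 - 4%:R * c0 * c2 != 0 ->
  localized (partial_ideal f) f^`M(2).
Proof.
move=> c0n c2n dn; have [_ LD LM] := localized_ideal (partial_ideal_is_ideal f).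
have mem u v e : e = u * f^`M(0) + v * f^`M(1) -> localized (partial_ideal f) e.
  by move=> ->; apply: sub_localized; exists u, v.
have fx := quartic_dx 0 0 0 c0 c1 c2 0 q0 q1 q2 q3 q4.
have fy := quartic_dy 0 0 0 c0 c1 c2 0 q0 q1 q2 q3 q4.
rewrite -/f mpolyC0 in fx fy.
have [|||||||Le1 Le2 Le3 Le4] := @nakayama4 k _ (partial_ideal_is_ideal f)
   (x ^+ 2 * y) (x ^+ 3) (x * y ^+ 2) (y ^+ 3)
   (3%:R * (c1 ^+ 2 - 4%:R * c0 * c2)%:MP * z ^+ 1 +
     (c1%:MP * 2%:R * q2%:MP - 18%:R * c0%:MP * q3%:MP) * y)
   (c1%:MP * (8%:R * q0%:MP * x + 5%:R * q1%:MP * y) - 6%:R * c0%:MP *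
     (q1%:MP * x + 2%:R * q2%:MP * y))
   (- (c1%:MP * q3%:MP + 24%:R * c0%:MP * q4%:MP) * y) (- (4%:R * c1%:MP * q4%:MP) * y)
   (3%:R * c1%:MP * z + 2%:R * q2%:MP * y)
     (6%:R * c0%:MP * z ^+ 1 + (8%:R * q0%:MP * x + 5%:R * q1%:MP * y)) (- q3%:MP * y)
     (- (4%:R * q4%:MP) * y)
   (c1%:MP * z + 2%:R * q2%:MP * y) (q1%:MP * y)
     (2%:R * c2%:MP * z ^+ 1 + 3%:R * q3%:MP * y) (4%:R * q4%:MP * y)
   (3%:R * c0%:MP * z + 3%:R * q1%:MP * y) (4%:R * q0%:MP * y)
     (2%:R * c1%:MP * z + 2%:R * q2%:MP * y) (1%:R * c2%:MP * z ^+ 1 + q3%:MP * y).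
- by split; apply: axis_unit => //; axis_zero.
- by split; axis_zero.
- by split; axis_zero.
- apply: (mem (2%:R * c1%:MP * x) (- c1%:MP * y - 6%:R * c0%:MP * x)).
  by rewrite fx fy mpolyCB !mpolyCM mpolyC_nat; ring.
- by apply: (mem (2%:R * x) (- y)); rewrite fx fy; ring.
- by apply: (mem 0 y); rewrite fx fy; ring.
- by apply: (mem y 0); rewrite fx fy; ring.
rewrite quartic_dz /cubic_form mpolyC0 mul0r addr0.
by apply: (LD); [apply: (LD)|]; apply: (LM).
Qed.

(** The tangent cone is x^2 (c0 x + c1 y). Suitable products of f_x and f_y by
    monomials have as initial forms, for the weights of the singularity, a basis
    of the monomials that generate the ideal of high weight; so this ideal is
    contained in the localized one, and contains f_z. The type is decided by the
    first nonvanishing coefficients: c1 (D or E), then q4 (odd D, E6) or q3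
    (D6, E7). *)
Lemma triple_point_DE c0 c1 q0 q1 q2 q3 q4 (f := quartic 0 0 0 c0 c1 0 0 q0 q1 q2 q3 q4) :
  c0 != 0 -> (q3 != 0) || (q4 != 0) ->
  localized (partial_ideal f) f^`M(2).
Proof.
move=> c0n q34; have [_ LD LM] := localized_ideal (partial_ideal_is_ideal f).
have mem u v e : e = u * f^`M(0) + v * f^`M(1) -> localized (partial_ideal f) e.
  by move=> ->; apply: sub_localized; exists u, v.
have fx := quartic_dx 0 0 0 c0 c1 0 0 q0 q1 q2 q3 q4.
have fy := quartic_dy 0 0 0 c0 c1 0 0 q0 q1 q2 q3 q4.
rewrite -/f mpolyC0 in fx fy.
suff [L1 L2] : localized (partial_ideal f) (c0%:MP * x ^+ 3) /\
    localized (partial_ideal f) (c1%:MP * (x ^+ 2 * y)).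
  rewrite quartic_dz /cubic_form mpolyC0 !mul0r !addr0.
  exact: LD.
have [c1z|c1n] := eqVneq c1 0; have [q4z|q4n] := eqVneq q4 0.
(* E7 in weights 3, 2: the monomials generate the weights at least 9. *)
- have q3n : q3 != 0 by move: q34; rewrite q4z eqxx orbF.
  rewrite c1z q4z mpolyC0 in fx fy *.
  have [|||||||_ _ Le _] := @nakayama4 k _ (partial_ideal_is_ideal f)
   (x ^+ 2 * y ^+ 2) (x * y ^+ 3) (x ^+ 3) (y ^+ 5)
   (3%:R * q3%:MP * z ^+ 0 + 0) 0 (2%:R * q2%:MP * y + q1%:MP * x) 0
   (2%:R * q2%:MP) (3%:R * q3%:MP * z ^+ 0 + 0) (q1%:MP * y) 0
   (2%:R * q2%:MP) q3%:MP (3%:R * c0%:MP * z ^+ 1 + (4%:R * q0%:MP * x + 3%:R * q1%:MP * y))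
     0
   (3%:R * c0%:MP * z + 3%:R * q1%:MP * y) (2%:R * q2%:MP * y) (4%:R * q0%:MP * y ^+ 2)
     (1%:R * q3%:MP * z ^+ 0 + 0).
  + by split; apply: axis_unit => //; axis_zero.
  + by split; axis_zero.
  + by split; axis_zero.
  + by apply: (mem 0 x); rewrite fx fy; ring.
  + by apply: (mem 0 y); rewrite fx fy; ring.
  + by apply: (mem x 0); rewrite fx fy; ring.
  + by apply: (mem (y ^+ 2) 0); rewrite fx fy; ring.
  split; first exact: LM.
  by apply: (mem 0 0); ring.
(* E6 in weights 4, 3: the monomials generate the weights at least 11. *)
- rewrite c1z mpolyC0 in fx fy *.
  have [|||||||_ _ _ Le] := @nakayama4 k _ (partial_ideal_is_ideal f)
   (x * y ^+ 3) (y ^+ 4) (x ^+ 2 * y) (x ^+ 3)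
   (4%:R * q4%:MP * z ^+ 0 + 0) 0 (3%:R * q3%:MP * y) (2%:R * q2%:MP * y + q1%:MP * x)
   (3%:R * q3%:MP) (4%:R * q4%:MP * z ^+ 0 + 0) (2%:R * q2%:MP * y) (q1%:MP * y)
   (2%:R * q2%:MP) q3%:MP (3%:R * c0%:MP * z ^+ 1 + 3%:R * q1%:MP * y) (4%:R * q0%:MP * y)
   q3%:MP 0 (2%:R * q2%:MP * y) (3%:R * c0%:MP * z ^+ 1 +
     (4%:R * q0%:MP * x + 3%:R * q1%:MP * y)).
  + by split; apply: axis_unit => //; axis_zero.
  + by split; axis_zero.
  + by split; axis_zero.
  + by apply: (mem 0 x); rewrite fx fy; ring.
  + by apply: (mem 0 y); rewrite fx fy; ring.
  + by apply: (mem y 0); rewrite fx fy; ring.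
  + by apply: (mem x 0); rewrite fx fy; ring.
  split; first exact: LM.
  by apply: (mem 0 0); ring.
(* D6 in weights 2, 1: the monomials generate the weights at least 5. *)
- have q3n : q3 != 0 by move: q34; rewrite q4z eqxx orbF.
  rewrite q4z mpolyC0 in fx fy *.
  have [|||||||Le1 Le2 _ _] := @nakayama4 k _ (partial_ideal_is_ideal f)
   (x ^+ 3) (x ^+ 2 * y) (x * y ^+ 3) (y ^+ 5)
   (1%:R * c1%:MP * z ^+ 1 + (q1%:MP * x + 2%:R * q2%:MP * y)) (3%:R * q3%:MP * y) 0 0
   (9%:R * c0%:MP * z + 12%:R * q0%:MP * x + 8%:R * q1%:MP * y)
     (5%:R * c1%:MP * z ^+ 1 + 4%:R * q2%:MP * y) 0 0
   (q1%:MP * y) (c1%:MP * z + 2%:R * q2%:MP * y) (3%:R * q3%:MP * z ^+ 0 + 0) 0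
   (4%:R * q0%:MP * y ^+ 2) (3%:R * c0%:MP * z * y + 3%:R * q1%:MP * y ^+ 2)
     (2%:R * c1%:MP * z + 2%:R * q2%:MP * y) (1%:R * q3%:MP * z ^+ 0 + 0).
  + by split; apply: axis_unit => //; axis_zero.
  + by split; axis_zero.
  + by split; axis_zero.
  + by apply: (mem 0 x); rewrite fx fy; ring.
  + by apply: (mem (3%:R * x) (- y)); rewrite fx fy; ring.
  + by apply: (mem 0 y); rewrite fx fy; ring.
  + by apply: (mem (y ^+ 2) 0); rewrite fx fy; ring.
  by split; apply: LM.
(* D5 in weights 3, 2: the monomials generate the weights at least 7. *)
have [|||||||Le1 Le2 _ _] := @nakayama4 k _ (partial_ideal_is_ideal f)
   (x ^+ 3) (x ^+ 2 * y) (y ^+ 4) (x * y ^+ 2)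
   (1%:R * c1%:MP * z ^+ 1 + (q1%:MP * x + 2%:R * q2%:MP * y)) (3%:R * q3%:MP * y) 0
     (4%:R * q4%:MP * y)
   (3%:R * c0%:MP * z + 4%:R * q0%:MP * x + 3%:R * q1%:MP * y)
     (2%:R * c1%:MP * z ^+ 1 + 2%:R * q2%:MP * y) 0 (q3%:MP * y)
   (q1%:MP * y) (c1%:MP * z + 2%:R * q2%:MP * y) (4%:R * q4%:MP * z ^+ 0 + 0)
     (3%:R * q3%:MP * y)
   (4%:R * q0%:MP * y) (3%:R * c0%:MP * z + 3%:R * q1%:MP * y) q3%:MP
     (2%:R * c1%:MP * z ^+ 1 + 2%:R * q2%:MP * y).
- by split; apply: axis_unit => //; axis_zero.
- by split; axis_zero.
- by split; axis_zero.
- by apply: (mem 0 x); rewrite fx fy; ring.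
- by apply: (mem x 0); rewrite fx fy; ring.
- by apply: (mem 0 y); rewrite fx fy; ring.
- by apply: (mem y 0); rewrite fx fy; ring.
by split; apply: LM.
Qed.
End QuarticGerms.

(** * Normal forms of singular quartics *)

Section NormalForms.
Variable k : closedFieldType.
Hypothesis chark : forall n, n.+1%:R != 0 :> k.
Local Notation A := {mpoly k[3]}.
Local Notation x := ('X_0 : A).
Local Notation y := ('X_1 : A).
Local Notation z := ('X_2 : A).
Local Notation base_point := (@base_point k).

Lemma quartic_expansion (f : A) : f \is 4.-homog ->
  (forall i, (f^`M(i)).@[base_point] = 0) ->
  exists a0 a1 a2 c0 c1 c2 c3 q0 q1 q2 q3 q4,
    f = quartic a0 a1 a2 c0 c1 c2 c3 q0 q1 q2 q3 q4.
Proof.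
move=> fh sing; pose c a b := (to_nested 0 1 f)`_a`_b`_(4 - a - b).
have fE : f = (c 0 0)%:MP * z ^+ 4 + z ^+ 3 * ((c 1 0)%:MP * x + (c 0 1)%:MP * y) +
    quartic (c 2 0) (c 1 1) (c 0 2) (c 3 0) (c 2 1) (c 1 2) (c 0 3)
      (c 4 0) (c 3 1) (c 2 2) (c 1 3) (c 0 4).
  rewrite -[LHS](pihomog_dE fh) -[in LHS](to_nestedK uniq_ord3 f) pihomog_nested.
  rewrite !big_ord_recl !big_ord0 /= /bump /=.
  rewrite /quartic /cubic_form /c; ring.
clearbody c.
have [z0 z1 z2] : [/\ c 0%N 0%N = 0, c 1%N 0%N = 0 & c 0%N 1%N = 0].
  have [P1 [P2 [P3 qE]]] : exists P1 P2 P3, quartic (c 2 0) (c 1 1) (c 0 2) (c 3 0)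
      (c 2 1) (c 1 2) (c 0 3) (c 4 0) (c 3 1) (c 2 2) (c 1 3) (c 0 4) =
      x * (x * P1) + x * (y * P2) + y * (y * P3).
    exists (z ^+ 2 * (c 2 0)%:MP + z * ((c 3 0)%:MP * x + (c 2 1)%:MP * y) +
      ((c 4 0)%:MP * x ^+ 2 + (c 3 1)%:MP * x * y + (c 2 2)%:MP * y ^+ 2)).
    exists (z ^+ 2 * (c 1 1)%:MP + z * ((c 1 2)%:MP * y) + (c 1 3)%:MP * y ^+ 2).
    exists (z ^+ 2 * (c 0 2)%:MP + z * ((c 0 3)%:MP * y) + (c 0 4)%:MP * y ^+ 2).
    by rewrite /quartic /cubic_form; ring.
  have b0 : base_point 0 = 0 by [].
  have b1 : base_point 1 = 0 by [].
  have b2 : base_point 2 = 1 by [].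
  have dE i : (f^`M(i)).@[base_point] = 4%:R * c 0 0 * (i == 2)%:R +
      (c 1 0 * (i == 0)%:R + c 0 1 * (i == 1)%:R).
    rewrite fE qE !(mderivD, mderivM, mderiv_exp, mderivC, mderiv_var).
    rewrite !(mevalD, mevalM, mevalC, mevalXU, rmorphXn, rmorph_nat, rmorph0, rmorph1) /=.
    rewrite b0 b1 b2; ring.
  move: (sing 0) (sing 1) (sing 2); rewrite !dE /= => e0 e1 e2.
  split; first apply: (mulfI (chark 3)).
  - by rewrite mulr0 -[RHS]e2; ring.
  - by rewrite -[RHS]e0; ring.
  - by rewrite -[RHS]e1; ring.
do 12 eexists; rewrite fE z0 z1 z2 mpolyC0 !mul0r addr0 mulr0 !add0r; reflexivity.
Qed.

(** The change of coordinates that replaces x_j by x_j + t x_i. *)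
Definition shear (i j : 'I_3) (t : k) : 'M[k]_3 := 1%:M + t *: delta_mx i j.

Lemma shear_unit i j t : i != j -> shear i j t \in unitmx.
Proof.
move=> ij; suff /mulmx1_unit[] : shear i j t *m shear i j (- t) = 1%:M by [].
rewrite /shear mulmxDl !mulmxDr !mul1mx mulmx1 -scalemxAl -scalemxAr.
by rewrite mul_delta_mx_0 1?eq_sym // !scaler0 addr0 scaleNr subrK.
Qed.

Lemma linear_var_shear i j t l :
  linear_var (shear i j t) l = 'X_l + (if l == j then t%:MP * 'X_i else 0).
Proof.
rewrite /linear_var; under eq_bigr do rewrite !mxE mpolyCD mulrDl.
rewrite big_split /= (bigD1 l) //= eqxx mpolyC1 mul1r big1 ?addr0 => [|m ml]; last first.
  by rewrite (negPf ml) mpolyC0 mul0r.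
congr (_ + _); rewrite (bigD1 i) //= eqxx big1 ?addr0 => [|m mi]; last first.
  by rewrite (negPf mi) mulr0 mpolyC0 mul0r.
by case: eqP => _; rewrite ?mulr1 // mulr0 mpolyC0 mul0r.
Qed.

Lemma row_act_shear i j t : i != 2 -> row_act (shear i j t) base_point = base_point.
Proof.
move=> i2; apply: funext => l; rewrite /row_act (bigD1 2) //= big1 ?addr0 => [|m m2].
  by rewrite /base_point eqxx mul1r !mxE [2 == i]eq_sym (negPf i2) /= mulr0 addr0 eq_sym.
by rewrite /base_point (negPf m2) mul0r.
Qed.

(** These hypotheses survive the linear changes fixing the base point that lead to
    the normal forms. *)
Definition singular_quartic (f : A) := [/\ f \is 4.-homog, reduced_mpoly f &
  forall i, (f^`M(i)).@[base_point] = 0].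

Lemma singular_quartic_change (f : A) M :
  M \in unitmx -> row_act M base_point = base_point ->
  singular_quartic f -> singular_quartic (linear_change M f).
Proof.
move=> uM fixM [fh fred sing]; split.
- exact: linear_change_homog.
- exact: linear_change_reduced.
move=> i; rewrite linear_change_deriv raddf_sum big1 // => l _ /=.
by rewrite mevalM linear_change_meval fixM sing mulr0.
Qed.

Ltac change_simpl := rewrite /quartic /cubic_form
  !(rmorphD, rmorphM, rmorphXn) /= !linear_changeC !linear_changeX !linear_var_shear /=
  ?mpolyCD ?mpolyCM ?mpolyC_nat ?mpolyC0.

Lemma quartic_shear01 a0 a1 a2 c0 c1 c2 c3 q0 q1 q2 q3 q4 t :
  linear_change (shear 0 1 t) (quartic a0 a1 a2 c0 c1 c2 c3 q0 q1 q2 q3 q4) =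
  quartic (a0 + a1 * t + a2 * t * t) (a1 + 2%:R * a2 * t) a2
   (c0 + c1 * t + c2 * t * t + c3 * t * t * t) (c1 + 2%:R * c2 * t + 3%:R * c3 * t * t)
   (c2 + 3%:R * c3 * t) c3
   (q0 + q1 * t + q2 * t * t + q3 * t * t * t + q4 * t * t * t * t)
   (q1 + 2%:R * q2 * t + 3%:R * q3 * t * t + 4%:R * q4 * t * t * t)
   (q2 + 3%:R * q3 * t + 6%:R * q4 * t * t) (q3 + 4%:R * q4 * t) q4.
Proof. by change_simpl; ring. Qed.

Lemma quartic_shear10 c0 c1 c2 c3 q0 q1 q2 q3 q4 t :
  linear_change (shear 1 0 t) (quartic 0 0 0 c0 c1 c2 c3 q0 q1 q2 q3 q4) =
  quartic 0 0 0
   c0 (c1 + 3%:R * c0 * t) (c2 + 2%:R * c1 * t + 3%:R * c0 * t * t)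
   (c3 + c2 * t + c1 * t * t + c0 * t * t * t)
   q0 (q1 + 4%:R * q0 * t) (q2 + 3%:R * q1 * t + 6%:R * q0 * t * t)
   (q3 + 2%:R * q2 * t + 3%:R * q1 * t * t + 4%:R * q0 * t * t * t)
   (q4 + q3 * t + q2 * t * t + q1 * t * t * t + q0 * t * t * t * t).
Proof. by change_simpl; ring. Qed.

(** One of 0, 1, -1 and 2 is not a root of a nonzero polynomial of degree at most
    3, as 6 is invertible. *)
Lemma exists_nonroot c0 c1 c2 c3 :
  [|| c0 != 0, c1 != 0, c2 != 0 | c3 != 0] ->
  exists t : k, c0 + c1 * t + c2 * t * t + c3 * t * t * t != 0.
Proof.
move=> nz; apply: contrapT => none.
have P t : c0 + c1 * t + c2 * t * t + c3 * t * t * t = 0.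
  by apply/eqP/negPn/negP => ne; apply: none; exists t.
have z0 : c0 = 0 by rewrite -[RHS](P 0); ring.
have z2 : c2 = 0.
  apply: (mulfI (chark 1)); rewrite mulr0 -[RHS]add0r -{2}(P 1) -(P (- 1)) z0; ring.
have z3 : c3 = 0.
  apply: (mulfI (chark 5)); rewrite mulr0 -[RHS](subr0 0) -{1}(P 2%:R).
  rewrite -[X in _ - X](mulr0 2%:R) -(P 1) z0 z2; ring.
have z1 : c1 = 0 by rewrite -[RHS](P 1) z0 z2 z3; ring.
by move: nz; rewrite z0 z1 z2 z3 eqxx.
Qed.

(** The factor s is the part of the form that is prime to y. *)
Lemma binary_form_split n (r : {poly k}) : r != 0 -> (size r <= n.+1)%N ->
  exists j s, axis s != 0 /\ binary_form 2 1 n r = y ^+ j * s.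
Proof.
elim: n r => [|n IHn] r r0 sr.
  exists 0%N, (binary_form 2 1 0 r); split; last by rewrite expr0 mul1r.
  rewrite /binary_form big_ord_recl big_ord0 addr0 !expr0 !mulr1 axisC polyC_eq0.
  by apply: contraNneq r0 => e; rewrite (size1_polyC sr) e.
have [r00|r00] := eqVneq r`_0 0; last first.
  exists 0%N, (binary_form 2 1 n.+1 r); split; last by rewrite expr0 mul1r.
  rewrite /binary_form big_ord_recl rmorphD rmorph_sum big1 => [|b _].
    by rewrite addr0 !rmorphM !rmorphXn /= axisC axisX2 axisX1 expr0 mulr1 mulf_neq0
      ?expf_neq0 ?polyX_eq0 ?polyC_eq0.
  by rewrite !rmorphM !rmorphXn /= axisX1 exprS mul0r mulr0.
have [q rE] : exists q, r = ('X - 0%:P) * q.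
  have /factor_theorem[q ->] : root r 0 by rewrite /root horner_coef0 r00.
  by exists q; rewrite mulrC.
have q0 : q != 0 by apply: contraNneq r0 => q0; rewrite rE q0 mulr0.
have sq : (size q <= n.+1)%N.
  by move: sr; rewrite rE size_mul ?polyXsubC_eq0 // size_XsubC.
have [j [s [s0 sE]]] := IHn q q0 sq.
exists j.+1, s; split=> //; rewrite rE binary_form_mul_linear // sE mpolyC0 mul0r subr0.
by rewrite exprS mulrA.
Qed.

Lemma double_point_nonvanishing a0 a1 a2 c0 c1 c2 c3 q0 q1 q2 q3 q4
    (f := quartic a0 a1 a2 c0 c1 c2 c3 q0 q1 q2 q3 q4) :
  singular_quartic f -> a0 != 0 -> nonvanishing_syzygy f base_point.
Proof.
move=> [fh fred _] a0n; apply: (localized_nonvanishing fh); apply: (localized_of_mem fh).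
have [n [r [u [v [r0 sr rE]]]]] := eliminant chark uniq_ord3 fh fred.
have [j [s [s0 sE]]] := binary_form_split r0 sr; rewrite sE in rE.
apply: (smooth_polar chark _ _ _ s0 rE).
- rewrite /f /quartic /cubic_form !(rmorphD, rmorphM, rmorphXn) /= axisX0 axisX1; ring.
- rewrite /f quartic_dx !(rmorphD, rmorphM, rmorphXn) /= axisX0 axisX1; ring.
rewrite /f quartic_dx !(mderivD, mderivM, mderiv_exp, mderivC, mderiv_var) /=.
rewrite !(rmorphD, rmorphM, rmorphXn, rmorph_nat, rmorph0, rmorph1) /= axisX0 axisX1
  axisX2 axisC.
rewrite (_ : _ + _ = 2%:R * a0%:P * 'X ^+ 2); last by ring.
by rewrite -polyC_natr !mulf_neq0 ?expf_neq0 ?polyC_eq0 ?polyX_eq0 ?chark.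
Qed.

Lemma reduced_not_square_x (f g : A) : reduced_mpoly f -> f <> x ^+ 2 * g.
Proof.
move=> fred /fred /unitrP[h [hx _]].
by have /eqP := congr1 (meval (fun=> 0)) hx;
  rewrite mevalM mevalXU mulr0 meval1 eq_sym oner_eq0.
Qed.

(** If q3 and q4 were both zero, then x^2 would divide f. *)
Lemma triple_point_with_double_line c0 c1 q0 q1 q2 q3 q4
    (f := quartic 0 0 0 c0 c1 0 0 q0 q1 q2 q3 q4) :
  singular_quartic f -> c0 != 0 -> nonvanishing_syzygy f base_point.
Proof.
move=> [fh fred _] c0n; apply: (localized_nonvanishing fh); apply: triple_point_DE => //.
apply/negPn/negP => /norP[/negPn/eqP q30 /negPn/eqP q40].
apply: (@reduced_not_square_x f (z * (c0%:MP * x + c1%:MP * y) +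
   (q0%:MP * x ^+ 2 + q1%:MP * x * y + q2%:MP * y ^+ 2)) fred).
by rewrite /f /quartic /cubic_form q30 q40 !mpolyC0; ring.
Qed.

(** A binary cubic form with roots t1, t2, t3 is moved by a shear so that x is
    one of its factors, and the double one if there is any. *)
Lemma triple_point_nonvanishing c0 c1 c2 c3 q0 q1 q2 q3 q4
    (f := quartic 0 0 0 c0 c1 c2 c3 q0 q1 q2 q3 q4) :
  singular_quartic f -> c0 != 0 -> nonvanishing_syzygy f base_point.
Proof.
move=> fg c0n.
have [t1 [t2 [t3 [e1 e2 e3]]]] : exists t1 t2 t3, [/\ c1 = - c0 * (t1 + t2 + t3),
    c2 = c0 * (t1 * t2 + t1 * t3 + t2 * t3) & c3 = - c0 * (t1 * t2 * t3)].
  (* The roots are those of the cubic at y = 1. *)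
  pose P := Poly [:: c3; c2; c1; c0].
  have PE : polyseq P = [:: c3; c2; c1; c0] by rewrite (@PolyK _ 0) //= .
  have [r Pr] := closed_field_poly_normal P.
  have lc : lead_coef P = c0 by rewrite /lead_coef PE.
  have sr : size r = 3.
    have : size P = (size r).+1 by rewrite Pr lc size_scale // size_prod_XsubC.
    by rewrite PE => -[].
  case: r sr Pr => [|t1 [|t2 [|t3 [|]]]] // _; rewrite lc !big_cons big_nil => Pr.
  exists t1, t2, t3.
  have coef i : P`_i = (c0 *: (('X - t1%:P) * (('X - t2%:P) * (('X - t3%:P) * 1))))`_i.
    by rewrite -Pr.
  have ex : c0 *: (('X - t1%:P) * (('X - t2%:P) * (('X - t3%:P) * 1))) =
     Poly [:: - c0 * (t1 * t2 * t3); c0 * (t1 * t2 + t1 * t3 + t2 * t3);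
       - c0 * (t1 + t2 + t3); c0].
    rewrite -mul_polyC /= !cons_poly_def !polyCM !polyCN !polyCD !polyCM; ring.
  move: coef; rewrite ex => coef.
  by split; [have := coef 2 | have := coef 1 | have := coef 0]; rewrite PE coef_Poly.
have step t : nonvanishing_syzygy (linear_change (shear 1 0 t) f) base_point ->
    nonvanishing_syzygy f base_point.
  by rewrite -{2}(@row_act_shear 1 0 t) //; apply/nonvanishing_syzygy_change/shear_unit.
have gg t : singular_quartic (linear_change (shear 1 0 t) f).
  by apply: singular_quartic_change => //; [apply: shear_unit | apply: row_act_shear].
have double t : c3 + c2 * t + c1 * t * t + c0 * t * t * t = 0 ->
   c2 + 2%:R * c1 * t + 3%:R * c0 * t * t = 0 -> nonvanishing_syzygy f base_point.
  move=> h3 h2; apply: (step t); have := gg t.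
  rewrite /f quartic_shear10 h3 h2 => g; exact: triple_point_with_double_line.
(* With a double root the shear by this root produces a double line x = 0. *)
have [t12|t12] := eqVneq t1 t2; first by apply: (double t1); rewrite ?e1 ?e2 ?e3 -t12; ring.
have [t13|t13] := eqVneq t1 t3; first by apply: (double t1); rewrite ?e1 ?e2 ?e3 -t13; ring.
have [t23|t23] := eqVneq t2 t3; first by apply: (double t2); rewrite ?e1 ?e2 ?e3 -t23; ring.
apply: (step t1); have := gg t1; rewrite /f quartic_shear10.
have -> : c3 + c2 * t1 + c1 * t1 * t1 + c0 * t1 * t1 * t1 = 0 by rewrite e1 e2 e3; ring.
move=> [fh _ _]; apply: (localized_nonvanishing fh); apply: triple_point_D4 => //.
  have -> : c2 + 2%:R * c1 * t1 + 3%:R * c0 * t1 * t1 = c0 * (t1 - t2) * (t1 - t3).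
    by rewrite e1 e2; ring.
  by rewrite !mulf_neq0 ?subr_eq0.
have -> : (c1 + 3%:R * c0 * t1) ^+ 2 - 4%:R * c0 *
  (c2 + 2%:R * c1 * t1 + 3%:R * c0 * t1 * t1) =
    (c0 * (t2 - t3)) ^+ 2 by rewrite e1 e2; ring.
by rewrite expf_neq0 // mulf_neq0 ?subr_eq0.
Qed.

(** A shear makes the coefficient of the highest power of x in the tangent cone
    nonzero. *)
Lemma singular_quartic_nonvanishing (f : A) :
  singular_quartic f -> nonvanishing_syzygy f base_point.
Proof.
move=> fg; have [fh fred sing] := fg.
have step t : nonvanishing_syzygy (linear_change (shear 0 1 t) f) base_point ->
    nonvanishing_syzygy f base_point.
  by rewrite -{2}(@row_act_shear 0 1 t) //; apply/nonvanishing_syzygy_change/shear_unit.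
have gg t : singular_quartic (linear_change (shear 0 1 t) f).
  by apply: singular_quartic_change => //; [apply: shear_unit | apply: row_act_shear].
have [a0 [a1 [a2 [c0 [c1 [c2 [c3 [q0 [q1 [q2 [q3 [q4 fE]]]]]]]]]]]] :=
  quartic_expansion fh sing.
rewrite fE in step gg *.
have [an|] := boolP [|| a0 != 0, a1 != 0, a2 != 0 | (0 : k) != 0].
  have [t] := exists_nonroot an; rewrite !mul0r addr0 => tn.
  by apply: (step t); have := gg t; rewrite quartic_shear01 => /double_point_nonvanishing;
    apply.
rewrite eqxx orbF !negb_or !negbK => /and3P[/eqP a00 /eqP a10 /eqP a20].
rewrite a00 a10 a20 in step gg *.
have [cn|] := boolP [|| c0 != 0, c1 != 0, c2 != 0 | c3 != 0].
  have [t tn] := exists_nonroot cn.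
  apply: (step t); have := gg t; rewrite quartic_shear01 !mulr0 !mul0r !addr0.
  by move/triple_point_nonvanishing; apply.
rewrite !negb_or !negbK => /and4P[/eqP -> /eqP -> /eqP -> /eqP ->].
exists (fun l => (l == 2)%:R); split; last by exists 2; rewrite meval1 oner_eq0.
rewrite (sum_ord3 _ uniq_ord3) quartic_dz /cubic_form !mpolyC0 /=; ring.
Qed.

Lemma singular_nonvanishing (f : A) (p : 'I_3 -> k) : f \is 4.-homog -> reduced_mpoly f ->
  (exists i, p i != 0) -> (forall i, (f^`M(i)).@[p] = 0) -> nonvanishing_syzygy f p.
Proof.
move=> fh fred [i pi] sing; pose P : 'rV[k]_3 := \row_l p l.
have P0 : P != 0 by apply: contraNneq pi => /rowP/(_ i); rewrite !mxE => ->.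
pose E : 'rV[k]_3 := delta_mx 0 2.
(* An invertible matrix whose last row is p. *)
have [|M uM EM] := @complete_unitmx k 1 3 E (const_mx 1 *m P).
  have -> : E *m (const_mx 1 *m P) = P.
    rewrite mulmxA -[RHS]mul1mx; congr (_ *m _); apply/matrixP => a b.
    rewrite mxE (bigD1 2) //= big1 ?addr0 => [|m m2]; rewrite !mxE ?ord1 ?eqxx ?mulr1 //.
    by rewrite (negPf m2) andbF.
  by rewrite !rank_rV P0; case: eqP => // /matrixP/(_ 0 2); rewrite !mxE eqxx => /eqP;
    rewrite oner_eq0.
have MP : row_act M base_point = p.
  apply: funext => l; have /rowP/(_ l) := EM.
  have -> : E *m (const_mx 1 *m P) = P.
    rewrite mulmxA -[RHS]mul1mx; congr (_ *m _); apply/matrixP => a b.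
    rewrite mxE (bigD1 2) //= big1 ?addr0 => [|m m2]; rewrite !mxE ?ord1 ?eqxx ?mulr1 //.
    by rewrite (negPf m2) andbF.
  rewrite !mxE => ->; apply: eq_bigr => m _; rewrite /base_point !mxE eqxx.
  by [].
rewrite -MP; apply: nonvanishing_syzygy_change => //; apply: singular_quartic_nonvanishing.
split; [exact: linear_change_homog|exact: linear_change_reduced|].
move=> j; rewrite linear_change_deriv raddf_sum big1 // => l _ /=.
by rewrite mevalM linear_change_meval MP sing mulr0.
Qed.
End NormalForms.

Theorem theorem2p9 (k : closedFieldType) (chark0 : [pchar k] =i pred0)
  (f : {mpoly k[3]}) (fhom : f \is 4.-homog) (fred : reduced_mpoly f)
  (fsing : singular_hypersurface f) : gradient_linear_type f.
Proof.
have chark n : n.+1%:R != 0 :> k by have /(pcharf0P k) -> := chark0.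
apply: (gradient_linear_type_of_local chark fhom fred) => p.
exact: singular_nonvanishing.
Qed.
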